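(* Consider the linear time-invariant system $\dot x=Ax+Gw$, $y=Cx+Hv$ with $A\in\mathbb{R}^{n\times n}$, $G\in\mathbb{R}^{n\times n}$, $C\in\mathbb{R}^{p\times n}$, $H$ such that $HH^{\top}>0$, and $(A,G,C)$ controllable and observable. Let $r\in\{1,\dots,n-1\}$ with $\mathrm{Re}(\lambda_r(A))>\mathrm{Re}(\lambda_{r+1}(A))$, and suppose $A$ has $r'$ unstable eigenvalues (counted with multiplicity). Fix $\bar U\in\mathcal{U}$ and run the low-rank approximated Kalman--Bucy filter with $U(t)\equiv\bar U$: $\tilde R(t)\in\mathbb{R}^{r\times r}$ solves \[\dot{\tilde R}=A_{\bar U}\tilde R+\tilde R A_{\bar U}^{\top}+G_{\bar U}G_{\bar U}^{\top}-\tilde R C_{\bar U}^{\top}(HH^{\top})^{-1}C_{\bar U}\tilde R,\quad \tilde R(0)>0,\] where $A_{\bar U}=\bar U^{\top}A\bar U$, $C_{\bar U}=C\bar U$, $G_{\bar U}=\bar U^{\top}G$; $\tilde P(t)=\bar U\tilde R(t)\bar U^{\top}$; and the error covariance $\tilde V(t)$ solves \[\dot{\tilde V}=(A-\tilde P C^{\top}(HH^{\top})^{-1}C)\tilde V+\tilde V(A-\tilde P C^{\top}(HH^{\top})^{-1}C)^{\top}+GG^{\top}+\tilde P C^{\top}(HH^{\top})^{-1}C\tilde P.\] Let $\tilde P_r:=\bar U\tilde R_{\bar U}\bar U^{\top}$, where $\tilde R_{\bar U}$ is the unique positive definite solution of the corresponding reduced algebraic Riccati equation $A_{\bar U}R+RA_{\bar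 U}^{\top}+G_{\bar U}G_{\bar U}^{\top}-RC_{\bar U}^{\top}(HH^{\top})^{-1}C_{\bar U}R=0$. Then $A-\tilde P_rC^{\top}(HH^{\top})^{-1}C$ is stable if and only if $r\ge r'$. Furthermore, if $A-\tilde P_rC^{\top}(HH^{\top})^{-1}C$ is stable, then the error covariance matrix $\tilde V(t)$ is bounded and converges to a steady-state solution.
   Context: Eigenvalues of $A$ are ordered as $\mathrm{Re}(\lambda_1(A))\ge\dots\ge\mathrm{Re}(\lambda_n(A))$. An eigenvalue is unstable if its real part is nonnegative; a matrix is stable if all its eigenvalues have negative real part. $\mathrm{St}(r,n):=\{X\in\mathbb{R}^{n\times r}\mid X^{\top}X=I_r\}$. $\Psi=[\psi_1,\dots,\psi_n]$ is an invertible matrix of unit-norm (generalized) eigenvectors of $A$ for $\lambda_1(A),\dots,\lambda_n(A)$ with $\Psi^{-1}A\Psi$ the Jordan form. $\mathcal{U}:=\{U\in\mathrm{St}(r,n)\mid \Psi^{-1}U=\begin{bsmallmatrix}K\\ O_{n-r,r}\end{bsmallmatrix}\text{ for some }K\in\mathbb{C}^{r\times r}\}$; these are equilibria of the Oja flow $\dot U=(I_n-UU^{\top})AU$, so $U(0)=\bar U$ gives $U(t)\equiv\bar U$. The initial condition $\tilde V(0)$ is a positive semidefinite matrix. *)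

(* Defs.v *)
From HB Require Import structures.
From mathcomp Require Import all_boot all_order all_algebra.
From mathcomp Require Import all_classical all_reals all_analysis.
From mathcomp Require Import complex.
Set Implicit Arguments. Unset Strict Implicit. Unset Printing Implicit Defensive.
Import Order.TTheory GRing.Theory Num.Theory.
Import numFieldNormedType.Exports.
Local Open Scope ring_scope.
Local Open Scope classical_set_scope.

Section Defs.
Variable R : realType.

Definition toCmx m n (M : 'M[R]_(m, n)) : 'M[R[i]]_(m, n) :=
  map_mx (real_complex R) M.

Definition posdef n (M : 'M[R]_n) : Prop :=
  M^T = M /\ forall x : 'cV[R]_n, x != 0 -> 0 < (x^T *m M *m x) 0 0.
Definition possemidef n (M : 'M[R]_n) : Prop :=
  M^T = M /\ forall x : 'cV[R]_n, 0 <= (x^T *m M *m x) 0 0.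

Definition controllable n m (A : 'M[R]_n) (B : 'M[R]_(n, m)) : bool :=
  (1%:M <= \big[addsmx/0]_(k < n) <<(A ^+ k *m B)^T>>)%MS.
Definition observable n p (A : 'M[R]_n) (C : 'M[R]_(p, n)) : bool :=
  controllable A^T C^T.

Definition stable n (A : 'M[R]_n) : Prop :=
  forall z : R[i], eigenvalue (toCmx A) z -> complex.Re z < 0.

(* Jordan normal form: bidiagonal, superdiagonal entries 0 or 1, and a 1
   only inside a block (equal neighbouring diagonal entries) *)
Definition is_jordan n (J : 'M[R[i]]_n) : Prop :=
  forall i j : 'I_n,
    ((j : nat) <> i -> (j : nat) <> i.+1 -> J i j = 0) /\
    ((j : nat) = i.+1 -> J i j = 0 \/ (J i j = 1 /\ J i i = J j j)).

(* Psi: invertible matrix of unit-norm (generalized) eigenvectors such that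
   Psi^-1 A Psi is the Jordan form with diagonal lambda_1(A),...,lambda_n(A)
   ordered by nonincreasing real part *)
Definition jordan_basis n (A : 'M[R]_n) (Psi : 'M[R[i]]_n) : Prop :=
  [/\ Psi \in unitmx,
      is_jordan (invmx Psi *m toCmx A *m Psi),
      (forall i j : 'I_n, (i <= j)%N ->
         complex.Re ((invmx Psi *m toCmx A *m Psi) j j) <=
         complex.Re ((invmx Psi *m toCmx A *m Psi) i i)) &
      (forall j : 'I_n,
         \sum_(i < n) (complex.Re (Psi i j) ^+ 2 + complex.Im (Psi i j) ^+ 2) = 1)].

(* lambda_k(A) (0-based index k) read off the Jordan form *)
Definition eig n (A : 'M[R]_n) (Psi : 'M[R[i]]_n) (k : 'I_n) : R[i] :=
  (invmx Psi *m toCmx A *m Psi) k k.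

Definition n_unstable n (A : 'M[R]_n) (Psi : 'M[R[i]]_n) : nat :=
  #|[set k : 'I_n | 0 <= complex.Re (eig A Psi k)]|.

Definition stiefel n r (U : 'M[R]_(n, r)) : Prop := U^T *m U = 1%:M.

Definition in_calU n r (Psi : 'M[R[i]]_n) (U : 'M[R]_(n, r)) : Prop :=
  stiefel U /\
  forall (i : 'I_n) (j : 'I_r), (r <= i)%N -> (invmx Psi *m toCmx U) i j = 0.

Definition riccati_rhs n p m (A : 'M[R]_n) (G : 'M[R]_(n, m))
    (C : 'M[R]_(p, n)) (W : 'M[R]_p) (X : 'M[R]_n) : 'M[R]_n :=
  A *m X + X *m A^T + G *m G^T - X *m C^T *m W *m C *m X.

Definition err_rhs n p (A G : 'M[R]_n) (C : 'M[R]_(p, n)) (W : 'M[R]_p)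
    (P V : 'M[R]_n) : 'M[R]_n :=
  (A - P *m C^T *m W *m C) *m V + V *m (A - P *m C^T *m W *m C)^T
  + G *m G^T + P *m C^T *m W *m C *m P.

Definition mx_ode_sol m (F : R -> 'M[R]_m) (f : R -> 'M[R]_m -> 'M[R]_m)
  : Prop :=
  forall i j : 'I_m,
    (fun t => F t i j) @ 0^'+ --> F 0 i j /\
    forall t : R, 0 < t -> is_derive t 1 (fun s => F s i j) (f t (F t) i j).

Definition mx_bounded m (F : R -> 'M[R]_m) : Prop :=
  exists M : R, forall t : R, 0 <= t -> forall i j, `|F t i j| <= M.

Definition mx_converges m (F : R -> 'M[R]_m) (L : 'M[R]_m) : Prop :=
  forall i j : 'I_m, F t i j @[t --> +oo] --> L i j.

End Defs.

(* Main.v *)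
Require Import Defs.
From HB Require Import structures.
From mathcomp Require Import all_boot all_order all_algebra.
From mathcomp Require Import all_classical all_reals all_analysis.
From mathcomp Require Import complex.
From mathcomp Require Import perm spectral mxred zify ring lra.
Import Order.TTheory GRing.Theory Num.Theory.
Import numFieldNormedType.Exports.
Set Implicit Arguments. Unset Strict Implicit. Unset Printing Implicit Defensive.
Local Open Scope ring_scope.

(** The range of [U] is [A]-invariant, so the closed loop
    [M = A - U Rs U^T C^T W C] is block triangular: its eigenvalues are those of
    [F = AU - Rs CU^T W CU] together with [lambda_(r+1), ..., lambda_n].  The
    reduced Riccati equation for [Rs > 0] and observability make [F] stable, so
    only the discarded eigenvalues of [A] matter for the stability of [M].

    For convergence, let [D = Rt - Rs], [S = CU^T W CU], and let [O] solve
    [F^T O + O F + S = 0].  Then [Z = D (1 + O D)^-1] satisfies the linear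
    equation [Z' = F Z + Z F^T], and [det (1 + O D)] solves a scalar linear
    equation, hence never vanishes if it is nonzero at time 0, which follows from
    [Rt 0 > 0] and [0 <= O <= Rs^-1].  So [Z -> 0] and [D -> 0].  The error
    covariance then follows a linear Lyapunov flow whose coefficients converge
    to those of a stable one.  In place of matrix exponentials, decay is measured
    by a quadratic form [|L x|^2] that contracts along a stable matrix. *)

(** * Frobenius inner product *)

Definition mxdot (R : realType) m n (X Y : 'M[R]_(m, n)) : R := \tr (X^T *m Y).

Section Dot.
Variable R : realType.

Lemma mxdotE m n (X Y : 'M[R]_(m, n)) :
  mxdot X Y = \sum_i \sum_j X i j * Y i j.
Proof.
rewrite /mxdot /mxtrace exchange_big; apply: eq_bigr => j _.
by rewrite mxE; apply: eq_bigr => i _; rewrite mxE.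
Qed.

Lemma mxdotC m n (X Y : 'M[R]_(m, n)) : mxdot X Y = mxdot Y X.
Proof. by rewrite /mxdot -mxtrace_tr trmx_mul trmxK. Qed.

Lemma mxdotDl m n (X Y Z : 'M[R]_(m, n)) :
  mxdot (X + Y) Z = mxdot X Z + mxdot Y Z.
Proof. by rewrite /mxdot linearD mulmxDl linearD. Qed.

Lemma mxdotDr m n (X Y Z : 'M[R]_(m, n)) :
  mxdot X (Y + Z) = mxdot X Y + mxdot X Z.
Proof. by rewrite !(mxdotC X) mxdotDl. Qed.

Lemma mxdotZl m n a (X Y : 'M[R]_(m, n)) : mxdot (a *: X) Y = a * mxdot X Y.
Proof. by rewrite /mxdot linearZ -scalemxAl linearZ. Qed.

Lemma mxdotZr m n a (X Y : 'M[R]_(m, n)) : mxdot X (a *: Y) = a * mxdot X Y.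
Proof. by rewrite mxdotC mxdotZl mxdotC. Qed.

Lemma mxdotNr m n (X Y : 'M[R]_(m, n)) : mxdot X (- Y) = - mxdot X Y.
Proof. by rewrite -scaleN1r mxdotZr mulN1r. Qed.

Lemma mxdotNl m n (X Y : 'M[R]_(m, n)) : mxdot (- X) Y = - mxdot X Y.
Proof. by rewrite mxdotC mxdotNr mxdotC. Qed.

Lemma mxdot0r m n (X : 'M[R]_(m, n)) : mxdot X 0 = 0.
Proof. by rewrite /mxdot mulmx0 mxtrace0. Qed.

Lemma mxdot_mull m n k (B : 'M[R]_(m, k)) (X : 'M[R]_(k, n)) Y :
  mxdot (B *m X) Y = mxdot X (B^T *m Y).
Proof. by rewrite /mxdot trmx_mul -mulmxA. Qed.

Lemma mxdot_tr m n (X Y : 'M[R]_(m, n)) : mxdot X^T Y^T = mxdot X Y.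
Proof. by rewrite /mxdot trmxK mxtrace_mulC -/(mxdot Y X) mxdotC. Qed.

Lemma mxdot_col m n (X Y : 'M[R]_(m, n)) :
  mxdot X Y = \sum_j mxdot (col j X) (col j Y).
Proof.
rewrite mxdotE exchange_big; apply: eq_bigr => j _; rewrite mxdotE.
by apply: eq_bigr => i _; rewrite big_ord1 !mxE.
Qed.

Lemma mxdot_ge0 m n (X : 'M[R]_(m, n)) : 0 <= mxdot X X.
Proof.
by rewrite mxdotE; do 2!apply: sumr_ge0 => ? _; rewrite -expr2 sqr_ge0.
Qed.

Lemma sqr_entry_le m n (X : 'M[R]_(m, n)) i j : X i j ^+ 2 <= mxdot X X.
Proof.
rewrite mxdotE (bigD1 i) //= (bigD1 j) //= -expr2 -addrA lerDl addr_ge0 //.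
  by apply: sumr_ge0 => ? _; rewrite -expr2 sqr_ge0.
by do 2!apply: sumr_ge0 => ? _; rewrite -expr2 sqr_ge0.
Qed.

Lemma mxdot_eq0 m n (X : 'M[R]_(m, n)) : mxdot X X <= 0 -> X = 0.
Proof.
move=> X0; apply/matrixP => i j; rewrite mxE; apply/eqP.
by rewrite -sqrf_eq0 eq_le sqr_ge0 andbT (le_trans (sqr_entry_le X i j)).
Qed.

Lemma mxdot_gt0 m n (X : 'M[R]_(m, n)) : X != 0 -> 0 < mxdot X X.
Proof.
by rewrite ltNge; apply: contraNN => /mxdot_eq0 ->.
Qed.

Lemma quad_mxdot n (M : 'M[R]_n) (x : 'cV[R]_n) :
  (x^T *m M *m x) 0 0 = mxdot x (M *m x).
Proof. by rewrite -trace_mx11 /mxdot mulmxA. Qed.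

(* AM-GM, with the weight [k] split so that a dissipation rate absorbs the
   second term *)
Lemma mxdot_young m n (k : R) (X Y : 'M[R]_(m, n)) : 0 < k ->
  2 * mxdot X Y <= mxdot X X / k + k * mxdot Y Y.
Proof.
move=> k0; have := mxdot_ge0 (X - k *: Y).
rewrite mxdotDl !mxdotDr !(mxdotNl, mxdotNr) !(mxdotZl, mxdotZr) (mxdotC Y X).
move=> h; rewrite -(ler_pM2l k0) mulrDr [k * (_ / k)]mulrC divfK ?gt_eqF //.
nra.
Qed.

(** Each term of the double sum is at most [b / 2] times two squares, and every square is counted
    [2 * n] times. This crude bound serves to absorb a small perturbation of a stable matrix. *)
Lemma mxdot_mul_le n (b : R) (B : 'M[R]_n) (x : 'cV[R]_n) :
  (forall i j, `|B i j| <= b) -> mxdot (B *m x) x <= b * n%:R * mxdot x x.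
Proof.
move=> Bb.
have sq : \sum_i x i 0 ^+ 2 = mxdot x x.
  by rewrite mxdotE; apply: eq_bigr => i _; rewrite big_ord1 expr2.
apply: (@le_trans _ _
  (\sum_i \sum_(j < n) b / 2 * (x j 0 ^+ 2 + x i 0 ^+ 2))).
  rewrite mxdotE; apply: ler_sum => i _; rewrite big_ord1 mxE big_distrl /=.
  apply: ler_sum => j _.
  have := Bb i j; rewrite ler_norml => /andP[b1 b2].
  move: (B i j) b1 b2 => e b1 b2; move: (x i 0) (x j 0) => u v.
  (* [(b - e) (u + v)^2 + (b + e) (u - v)^2 >= 0] expands to [e u v <= b / 2 (u^2 + v^2)]. *)
  have := mulr_ge0 (_ : 0 <= b - e) (sqr_ge0 (u + v)).
  have := mulr_ge0 (_ : 0 <= b + e) (sqr_ge0 (u - v)).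
  move=> /(_ ltac:(lra)) h1 /(_ ltac:(lra)) h2; nra.
under eq_bigr => i _ do
  rewrite -mulr_sumr big_split /= sq sumr_const card_ord -[_ ^+ 2 *+ n]mulr_natr.
rewrite -mulr_sumr big_split /= -mulr_suml sq sumr_const card_ord.
rewrite -[mxdot x x *+ n]mulr_natr.
by rewrite le_eqVlt; apply/orP; left; apply/eqP; field.
Qed.
End Dot.

(** * Contracting quadratic forms of stable matrices *)

Section Contraction.
Variable R : realType.
Implicit Types n : nat.

Local Notation Rem := (map_mx (@complex.Re R)).
Local Notation Imm := (map_mx (@complex.Im R)).

(** Schur triangularization, in lower triangular form. The diagonal entries are roots of the
    characteristic polynomial of [T], and similarity carries them back to [A]. *)
Lemma trigonal_similar n (A : 'M[R[i]]_n) :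
  exists P : 'M[R[i]]_n, exists T : 'M[R[i]]_n,
  [/\ P \in unitmx, P *m A = T *m P,
      (forall i j : 'I_n, (i < j)%N -> T i j = 0)
    & forall i, eigenvalue A (T i i)].
Proof.
have [] := @cotrigonalization _ n [:: A].
  by move=> ? ? /=; rewrite !in_cons !orbF => /eqP-> /eqP->.
move=> P /unitarymx_unit Pu /=; rewrite andbT => trT.
exists P, (mxred.conjmx P A); split=> //.
- by rewrite conjumx // mulmxKV.
- by apply/is_trig_mxP.
move=> i; apply: (@eigenvalue_conjmx _ _ _ P A).
- by rewrite submx_full // row_full_unit.
- by rewrite row_free_unit.
rewrite -topredE /= eigenvalue_root_char char_poly_trig //.
by rewrite /root horner_prod (bigD1 i) //= !hornerE subrr mul0r.
Qed.

Lemma Re_sum I (r : seq I) (P : pred I) (f : I -> R[i]) :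
  complex.Re (\sum_(i <- r | P i) f i) = \sum_(i <- r | P i) complex.Re (f i).
Proof. by apply: (big_morph (@complex.Re R)) => // -[a b] []. Qed.

Lemma Im_sum I (r : seq I) (P : pred I) (f : I -> R[i]) :
  complex.Im (\sum_(i <- r | P i) f i) = \sum_(i <- r | P i) complex.Im (f i).
Proof. by apply: (big_morph (@complex.Im R)) => // -[a b] []. Qed.

Lemma Rem_mul m n k (A : 'M[R[i]]_(m, n)) (B : 'M[R[i]]_(n, k)) :
  Rem (A *m B) = Rem A *m Rem B - Imm A *m Imm B.
Proof.
apply/matrixP => i j; rewrite !mxE Re_sum -sumrB; apply: eq_bigr => l _.
by rewrite !mxE; case: (A i l) (B l j) => a b [].
Qed.

Lemma Imm_mul m n k (A : 'M[R[i]]_(m, n)) (B : 'M[R[i]]_(n, k)) :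
  Imm (A *m B) = Rem A *m Imm B + Imm A *m Rem B.
Proof.
apply/matrixP => i j; rewrite !mxE Im_sum -big_split /=; apply: eq_bigr => l _.
by rewrite !mxE; case: (A i l) (B l j) => a b [].
Qed.

Lemma Rem_toCmx m n (A : 'M[R]_(m, n)) : Rem (toCmx A) = A.
Proof. by apply/matrixP => i j; rewrite !mxE. Qed.

Lemma Imm_toCmx m n (A : 'M[R]_(m, n)) : Imm (toCmx A) = 0.
Proof. by apply/matrixP => i j; rewrite !mxE. Qed.

(** The minimum starts from [1], which keeps it positive for an empty index set too. *)
Lemma finite_neg_bound n (f : 'I_n -> R) : (forall i, f i < 0) ->
  exists2 a : R, 0 < a & forall i, f i <= - a.
Proof.
move=> f0; exists (\big[Order.min/1]_i - f i).
  by elim/big_ind: _ => // [x y x0 y0|i _]; rewrite ?lt_min ?x0 // oppr_gt0.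
move=> i; rewrite lerNr; exact: bigmin_le_cond.
Qed.

(* With [T] the Schur form of [A] in the basis [P] and [D = diag(eps ^ i)], the
   off-diagonal part of [D T D^-1] is of order [eps]. *)
Lemma stable_contraction n (A : 'M[R]_n) : stable A ->
  exists m (L : 'M[R]_(m, n)) (L' : 'M[R]_(n, m)) (c : R),
  [/\ 0 < c, L' *m L = 1%:M &
      forall x : 'cV[R]_n,
        mxdot (L *m (A *m x)) (L *m x) <= - c * mxdot (L *m x) (L *m x)].
Proof.
move=> sA.
have [P [T [Pu PA Ttrig Teig]]] := trigonal_similar (toCmx A).
have [a a0 Ta] := finite_neg_bound (fun i => sA _ (Teig i)).
(* A real-valued size of complex entries that avoids square roots; [K] bounds it over all entries of
   [T]. *)
pose rn (z : R[i]) : R := `|complex.Re z| + `|complex.Im z|.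
pose K := \sum_i \sum_j rn (T i j).
have K0 : 0 <= K by do 2!apply: sumr_ge0 => ? _; rewrite addr_ge0.
have KT i j : rn (T i j) <= K.
  rewrite /K (bigD1 i) //= (bigD1 j) //= -addrA lerDl addr_ge0 //.
    by apply: sumr_ge0 => ? _; rewrite addr_ge0.
  by do 2!apply: sumr_ge0 => ? _; rewrite addr_ge0.
(* Chosen so that off-diagonal entries of size [b] cost at most [a / 2] of the rate [a]; [n.+1]
   keeps the denominator nonzero when [n = 0]. *)
pose b : R := a / (2 * n.+1%:R).
have b0 : 0 < b by rewrite divr_gt0 // mulr_gt0.
pose e := Num.min 1 (b / (K + 1)).
have e0 : 0 < e by rewrite lt_min ltr01 divr_gt0 // ltr_wpDl.
have e1 : e <= 1 by rewrite ge_min lexx.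
have eK : e * K <= b.
  apply: (@le_trans _ _ (b / (K + 1) * K)).
    by rewrite ler_wpM2r // ge_min lexx orbT.
  rewrite -mulrA ler_piMr ?(ltW b0) // mulrC ler_pdivrMr ?ltr_wpDl //.
  by rewrite mul1r lerDl.
pose D : 'M[R[i]]_n := diag_mx (\row_i ((e ^+ i)%:C)%C).
pose D' : 'M[R[i]]_n := diag_mx (\row_i ((e ^- i)%:C)%C).
have D'D : D' *m D = 1%:M.
  rewrite mulmx_diag -diag_const_mx; congr diag_mx.
  apply/rowP => i; rewrite !mxE -rmorphM mulVf ?rmorph1 //.
  by rewrite expf_neq0 // gt_eqF.
pose Q := D *m P.
pose Q' := invmx P *m D'.
have Q'Q : Q' *m Q = 1%:M.
  by rewrite /Q' /Q mulmxA -(mulmxA (invmx P)) D'D mulmx1 mulVmx.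
pose B := D *m T *m D'.
have QA : Q *m toCmx A = B *m Q.
  by rewrite /B /Q -mulmxA PA !mulmxA -(mulmxA (D *m T)) D'D mulmx1.
have BE i j : B i j = (e ^+ i * e ^- j)%:C%C * T i j.
  rewrite /B mul_mx_diag mxE /D mul_diag_mx !mxE rmorphM /=.
  by rewrite -mulrA (mulrC (T i j)) mulrA.
have Boff i j : i != j -> rn (B i j) <= b.
  (* Above the diagonal [T] vanishes; below it the conjugation scales by [e ^ (i - j) <= e]. *)
  rewrite BE; have [ij _|ji ij|/val_inj -> /eqP//] := ltngtP i j.
    by rewrite Ttrig // mulr0 /rn /= normr0 addr0 ltW.
  have : 0 <= e ^+ i * e ^- j <= e.
    rewrite -(subnK (ltnW ji)) exprD mulfK ?expf_neq0 ?gt_eqF //.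
    rewrite exprn_ge0 ?(ltW e0) //= -(subnK (_ : 0 < i - j)%N) ?subn_gt0 //.
    by rewrite addn1 exprS ler_piMr ?(ltW e0) // exprn_ile1 // ltW.
  move: (e ^+ i * e ^- j) => s /andP[s0 se].
  apply: le_trans eK; apply: le_trans (ler_wpM2l (ltW e0) (KT i j)).
  rewrite /rn; case: (T i j) => u v /=; rewrite !mul0r subr0 addr0 !normrM.
  by rewrite (ger0_norm s0) -mulrDr ler_wpM2r // addr_ge0.
have Bdiag i : complex.Re (B i i) <= - a.
  by rewrite BE mulfV ?mul1r ?Ta // expf_neq0 // gt_eqF.
(* Stacking real and imaginary parts makes [Q] real; the product of the two witnesses is the real
   part of [Q' Q = 1]. *)
exists (n + n)%N, (col_mx (Rem Q) (Imm Q)), (row_mx (Rem Q') (- Imm Q')), (a / 2).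
split; first by rewrite divr_gt0.
  rewrite mul_row_col mulNmx -Rem_mul Q'Q.
  by apply/matrixP => i j; rewrite !mxE; case: eqP.
move=> x.
have QX (z : 'cV[R]_n) : col_mx (Rem Q) (Imm Q) *m z =
    col_mx (Rem (Q *m toCmx z)) (Imm (Q *m toCmx z)).
  by rewrite mul_col_mx Rem_mul Imm_mul Rem_toCmx Imm_toCmx !mulmx0 subr0 add0r.
rewrite !QX /toCmx map_mxM mulmxA -/(toCmx A) QA -mulmxA.
move: (Q *m _) => y {QX}.
have dotE (u v : 'cV[R[i]]_n) :
    mxdot (col_mx (Rem u) (Imm u)) (col_mx (Rem v) (Imm v)) =
    \sum_i (complex.Re (u i 0) * complex.Re (v i 0)
           + complex.Im (u i 0) * complex.Im (v i 0)).
  rewrite /mxdot tr_col_mx mul_row_col linearD /= -!/(mxdot _ _) !mxdotE.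
  by rewrite -big_split /=; apply: eq_bigr => i _; rewrite !big_ord1 !mxE.
rewrite !dotE.
pose nn i := complex.Re (y i 0) ^+ 2 + complex.Im (y i 0) ^+ 2.
have nn0 i : 0 <= nn i by rewrite addr_ge0 ?sqr_ge0.
apply: (@le_trans _ _
  (\sum_i (- a * nn i + \sum_(j < n) b / 2 * (nn j + nn i)))).
  apply: ler_sum => i _; rewrite mxE Re_sum Im_sum !big_distrl /= -big_split /=.
  rewrite (bigD1 i) //=; apply: lerD.
    have := Bdiag i; rewrite /nn.
    case: (B i i) (y i 0) => p q [u v] /= pa.
    have := ler_wpM2r (addr_ge0 (sqr_ge0 u) (sqr_ge0 v)) pa.
    by congr (_ <= _); ring.
  rewrite [leRHS](bigD1 i) //= -[leLHS]add0r lerD //.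
    by apply: mulr_ge0; [lra | apply: addr_ge0].
  apply: ler_sum => j; rewrite eq_sym => /Boff; rewrite /nn /rn.
  case: (B i j) (y i 0) (y j 0) => p q [u v] [s t] /= pq.
  have [/ler_normlP[p1 p2] /ler_normlP[q1 q2]] := (lexx `|p|, lexx `|q|).
  (* The cross term is [p (s u + t v) + q (s v - t u)]. The first four products bound it by
     [(|p| + |q|) / 2] times the sum of the four squares, and the fifth replaces [|p| + |q|] by
     [b]. *)
  have := mulr_ge0 (_ : 0 <= `|p| - p)
    (addr_ge0 (sqr_ge0 (s + u)) (sqr_ge0 (t + v))).
  have := mulr_ge0 (_ : 0 <= `|p| + p)
    (addr_ge0 (sqr_ge0 (s - u)) (sqr_ge0 (t - v))).
  have := mulr_ge0 (_ : 0 <= `|q| - q)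
    (addr_ge0 (sqr_ge0 (s + v)) (sqr_ge0 (t - u))).
  have := mulr_ge0 (_ : 0 <= `|q| + q)
    (addr_ge0 (sqr_ge0 (s - v)) (sqr_ge0 (t + u))).
  have := mulr_ge0 (_ : 0 <= b - (`|p| + `|q|))
    (addr_ge0 (addr_ge0 (sqr_ge0 s) (sqr_ge0 t))
              (addr_ge0 (sqr_ge0 u) (sqr_ge0 v))).
  move=> /(_ ltac:(lra)) h1 /(_ ltac:(lra)) h2 /(_ ltac:(lra)) h3.
  move=> /(_ ltac:(lra)) h4 /(_ ltac:(lra)) h5.
  lra.
have -> : \sum_i (complex.Re (y i 0) * complex.Re (y i 0)
    + complex.Im (y i 0) * complex.Im (y i 0)) = \sum_i nn i.
  by apply: eq_bigr => i _; rewrite -!expr2.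
move: nn nn0 => nn nn0.
have -> : \sum_i (- a * nn i + \sum_(j < n) b / 2 * (nn j + nn i)) =
    (- a + b * n%:R) * \sum_i nn i.
  under eq_bigr => i _ do
    rewrite -mulr_sumr big_split /= sumr_const card_ord -[_ *+ n]mulr_natr.
  rewrite big_split /= -!mulr_sumr big_split /= -mulr_suml sumr_const card_ord.
  by rewrite -[_ *+ n]mulr_natr; field.
apply: ler_wpM2r; first exact: sumr_ge0.
have : b * n%:R <= b * n.+1%:R by rewrite ler_wpM2l ?(ltW b0) // ler_nat.
have -> : b * n.+1%:R = a / 2 by rewrite /b; field.
lra.
Qed.
End Contraction.

(** * Lyapunov equations *)

Section Spectral.
Variable R : realType.
Implicit Types n : nat.

Lemma eigenvalue_trmx (F : fieldType) n (A : 'M[F]_n) :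
  eigenvalue A^T =1 eigenvalue A.
Proof.
move=> z; rewrite !eigenvalue_root_char; congr (root _ z).
rewrite /char_poly -[RHS]det_tr; congr (\det _).
by rewrite /char_poly_mx linearB /= tr_scalar_mx map_trmx.
Qed.

Lemma stable_trmx n (A : 'M[R]_n) : stable A -> stable A^T.
Proof. by move=> sA z; rewrite /toCmx -map_trmx eigenvalue_trmx; apply: sA. Qed.

(** [eigenvalue] speaks of left eigenvectors, hence the transposition; [a] and [b] are the real and
    imaginary parts of a right eigenvector. *)
Lemma real_eigenpair n (A : 'M[R]_n) (z : R[i]) : eigenvalue (toCmx A) z ->
  exists a b : 'cV[R]_n, [/\ (a != 0) || (b != 0),
    A *m a = complex.Re z *: a - complex.Im z *: b &
    A *m b = complex.Im z *: a + complex.Re z *: b].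
Proof.
rewrite -eigenvalue_trmx => /eigenvalueP[v vA v0].
have Ax : toCmx A *m v^T = z *: v^T.
  by rewrite -[toCmx A]trmxK -trmx_mul vA linearZ.
exists (map_mx (@complex.Re R) v^T), (map_mx (@complex.Im R) v^T); split.
- apply: contraNT v0; rewrite negb_or !negbK => /andP[/eqP a0 /eqP b0].
  apply/eqP/rowP => i; move/colP/(_ i): a0; move/colP/(_ i): b0.
  by rewrite !mxE; case: (v 0 i) => a b /= -> ->.
- have := Rem_mul (toCmx A) v^T.
  rewrite Rem_toCmx Imm_toCmx mul0mx subr0 Ax => <-.
  by apply/colP => i; rewrite !mxE; case: (v 0 i) z {vA Ax} => a b [].
- have := Imm_mul (toCmx A) v^T.
  rewrite Rem_toCmx Imm_toCmx mul0mx addr0 Ax => <-.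
  apply/colP => i; rewrite !mxE; case: (v 0 i) z {vA Ax} => a b [u w] /=.
  by rewrite addrC.
Qed.

Lemma mxdot_contraction m n k (L : 'M[R]_(m, n)) (M : 'M[R]_n) (c : R) :
  (forall x : 'cV[R]_n,
     mxdot (L *m (M *m x)) (L *m x) <= - c * mxdot (L *m x) (L *m x)) ->
  forall Y : 'M[R]_(n, k),
    mxdot (L *m (M *m Y)) (L *m Y) <= - c * mxdot (L *m Y) (L *m Y).
Proof.
move=> LM Y; rewrite mxdot_col [leRHS]mulrC [in leRHS]mxdot_col mulr_suml.
apply: ler_sum => j _; rewrite mulrC !colE -!mulmxA.
exact: LM.
Qed.

(** The term [M X] contracts the columns of [X L^T] at rate [c], and [X M^T] is the same situation
    for [X^T]; the two rates add up. *)
Lemma lyapunov_contraction m n (L : 'M[R]_(m, n)) (M : 'M[R]_n) (c : R) :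
  (forall x : 'cV[R]_n,
     mxdot (L *m (M *m x)) (L *m x) <= - c * mxdot (L *m x) (L *m x)) ->
  forall X : 'M[R]_n,
    mxdot (L *m (M *m X + X *m M^T) *m L^T) (L *m X *m L^T) <=
    - (2 * c) * mxdot (L *m X *m L^T) (L *m X *m L^T).
Proof.
move=> LM X.
have h1 := mxdot_contraction LM (X *m L^T).
have h2 := mxdot_contraction LM (X^T *m L^T).
rewrite mulmxDr mulmxDl mxdotDl.
have e : mxdot (L *m X^T *m L^T) (L *m X^T *m L^T) =
         mxdot (L *m X *m L^T) (L *m X *m L^T).
  by rewrite -mxdot_tr !trmx_mul !trmxK mulmxA.
rewrite !mulmxA e in h1 h2.
have e2 : mxdot (L *m M *m X^T *m L^T) (L *m X^T *m L^T) =
    mxdot (L *m X *m M^T *m L^T) (L *m X *m L^T).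
  by rewrite -mxdot_tr !trmx_mul !trmxK !mulmxA.
rewrite e2 in h2.
rewrite !mulmxA; lra.
Qed.

(** The contraction leaves the Lyapunov operator a trivial kernel, so in finite dimension it is
    invertible. Averaging a solution with its transpose makes it symmetric. *)
Lemma lyapunov_solve n (M Q : 'M[R]_n) : stable M -> Q^T = Q ->
  exists2 X : 'M[R]_n, X^T = X & M *m X + X *m M^T + Q = 0.
Proof.
move=> /stable_contraction[m [L [L' [c [c0 LL LM]]]]] QT.
pose f (X : 'M[R]_n) := M *m X + X *m M^T.
have fD a X Y : f (a *: X + Y) = a *: f X + f Y.
  by rewrite /f !mulmxDr !mulmxDl -!scalemxAr -!scalemxAl scalerDr addrACA.
pose fl : {linear 'M[R]_n -> 'M[R]_n} :=
  HB.pack f (GRing.isLinear.Build _ _ _ _ f fD).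
have fu : lin_mx fl \in unitmx.
  rewrite -row_free_unit; apply/inj_row_free => v v0.
  have : fl (vec_mx v) = 0.
    by apply: (can_inj mxvecK); rewrite -mul_vec_lin vec_mxK v0 linear0.
  move=> fv; have := lyapunov_contraction LM (vec_mx v).
  rewrite -/(f _) -[f _]/(fl _) fv mulmx0 mul0mx mxdotC mxdot0r mulNr oppr_ge0.
  rewrite pmulr_rle0 ?mulr_gt0 // => /mxdot_eq0 LX.
  have : vec_mx v = L' *m (L *m vec_mx v *m L^T) *m L'^T.
    by rewrite !mulmxA LL mul1mx -mulmxA -trmx_mul LL trmx1 mulmx1.
  by rewrite LX mulmx0 mul0mx => vv; rewrite -[v]vec_mxK vv linear0.
pose X := vec_mx (mxvec (- Q) *m invmx (lin_mx fl)).
have fX : f X = - Q.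
  apply: (can_inj mxvecK); rewrite -[f X]/(fl X) -mul_vec_lin /X vec_mxK.
  by rewrite mulmxKV.
have fXT : f X^T = - Q.
  have -> : f X^T = (f X)^T by rewrite /f linearD /= !trmx_mul trmxK addrC.
  by rewrite fX linearN /= QT.
exists (2^-1 *: (X + X^T)); first by rewrite linearZ /= linearD /= trmxK addrC.
rewrite -/(f _) -[_ *: _]addr0 fD.
have -> : f (X + X^T) = f X + f X^T by rewrite -[X]scale1r fD !scale1r.
have -> : f 0 = 0 by rewrite -[RHS](linear0 fl).
rewrite addr0 fX fXT -mulr2n -(scaler_nat 2 (- Q)) scalerA mulVf ?pnatr_eq0 //.
by rewrite scale1r addNr.
Qed.
End Spectral.

(** * Positivity of solutions of Lyapunov inequalities *)

Section Lyapunov.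
Variable R : realType.
Implicit Types n : nat.

Lemma continuous_quad n (B : 'M[R]_n) :
  continuous (fun v : 'rV[R]_n => mxdot v^T (B *m v^T)).
Proof.
have -> : (fun v : 'rV[R]_n => mxdot v^T (B *m v^T)) =
    (fun v => \sum_i v 0 i * \sum_j (B i j * v 0 j)).
  apply/funext => v; rewrite mxdotE; apply: eq_bigr => i _.
  rewrite big_ord1 !mxE; congr (_ * _); apply: eq_bigr => j _; by rewrite !mxE.
apply: continuous_big => [|i _ v]; first exact: add_continuous.
apply: (@cvgM _ _ (nbhs v) (nbhs_filter v)).
  exact: (@coord_continuous R 1 n 0 i v).
apply: cvg_big => [|j _]; first exact: add_continuous.
apply: (@cvgM _ _ (nbhs v) (nbhs_filter v)); first exact: cvg_cst.
exact: (@coord_continuous R 1 n 0 j v).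
Qed.

(** The quotient of the two forms is invariant under scaling, so its minimum over the compact unit
    sphere is global. The vector [y] shows that the sphere is nonempty. *)
Lemma rayleigh_min m n (L : 'M[R]_(m, n)) (L' : 'M[R]_(n, m)) (X : 'M[R]_n)
    (y : 'cV[R]_n) : L' *m L = 1%:M -> y != 0 ->
  exists (mu : R) (x0 : 'cV[R]_n), [/\ x0 != 0,
    mxdot x0 (X *m x0) = mu * mxdot (L *m x0) (L *m x0) &
    forall x : 'cV[R]_n, mu * mxdot (L *m x) (L *m x) <= mxdot x (X *m x)].
Proof.
move=> LL y0.
have Lpos (x : 'cV_n) : x != 0 -> 0 < mxdot (L *m x) (L *m x).
  move=> x0; apply: mxdot_gt0; apply: contra_neq x0 => Lx.
  by rewrite -[x]mul1mx -LL -mulmxA Lx mulmx0.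
pose A := [set v : 'rV[R]_n | `|v| = 1]%classic.
pose f (v : 'rV[R]_n) :=
  mxdot v^T (X *m v^T) / mxdot v^T ((L^T *m L) *m v^T).
have LE (v : 'cV_n) : mxdot v ((L^T *m L) *m v) = mxdot (L *m v) (L *m v).
  by rewrite [RHS]mxdot_mull mulmxA.
have normalized (x : 'cV_n) : x != 0 ->
    exists2 a : R, 0 < a & A (a *: x^T).
  move=> x0; have nx : 0 < `|x^T| by rewrite normr_gt0 trmx_eq0.
  exists (`|x^T|^-1); first by rewrite invr_gt0.
  by rewrite /A /= normrZ gtr0_norm ?invr_gt0 // mulVf // gt_eqF.
have Ane : A !=set0%classic.
  by have [a _ Aa] := normalized _ y0; exists (a *: y^T).
have Acpt : compact A.
  apply: bounded_closed_compact.
    exists 1; split; first exact: num_real.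
    by move=> r r1 v; rewrite /A /= => ->; exact: ltW.
  have -> : A = (Num.norm @^-1` [set x : R | x = 1])%classic by [].
  apply: preimage_closed; last exact: closed_eq.
  by move=> v _; exact: norm_continuous.
have A_neq0 (v : 'rV_n) : A v -> v^T != 0.
  by rewrite /A /= trmx_eq0 -normr_gt0 => ->.
have fcont : {within A, continuous f}%classic.
  apply: continuous_in_subspaceT => v; rewrite inE => Av.
  apply: (@cvgM _ _ (nbhs v) (nbhs_filter v)).
    exact: (continuous_quad (x := v)).
  apply: (@cvgV _ _ (nbhs v) (nbhs_filter v)).
    by rewrite LE gt_eqF // Lpos // A_neq0.
  exact: (continuous_quad (x := v)).
have [v] := EVT_min_rV Ane Acpt fcont; rewrite inE => Av fmin.
exists (f v), v^T; split; first exact: A_neq0.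
  by rewrite -LE /f divfK // LE gt_eqF // Lpos // A_neq0.
move=> x; have [->|x0] := eqVneq x 0.
  by rewrite !mulmx0 !mxdot0r mulr0.
have [a a0 Aax] := normalized _ x0.
have := fmin (a *: x^T); rewrite inE => /(_ Aax).
rewrite /f !LE; set fv := (X in X <= _).
rewrite linearZ /= trmxK -!scalemxAr !mxdotZl !mxdotZr !mulrA -mulf_div.
rewrite mulfV ?gt_eqF ?mulr_gt0 // mul1r ler_pdivlMr ?Lpos //.
Qed.

(* A minimiser [x0] of the quotient of the two forms satisfies
   [X x0 = mu L^T L x0]; testing this against [M x0] gives [mu >= 0]. *)
Lemma lyapunov_psd n (M X : 'M[R]_n) : stable M -> X^T = X ->
  (forall x : 'cV[R]_n, mxdot x (X *m (M *m x)) <= 0) ->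
  forall x : 'cV[R]_n, 0 <= mxdot x (X *m x).
Proof.
move=> /stable_contraction[m [L [L' [c [c0 LL LM]]]]] XT XM x.
have [->|x0] := eqVneq x 0; first by rewrite mulmx0 mxdot0r.
have [mu [u [u0 umu mumin]]] := rayleigh_min X LL x0.
have Lu : 0 < mxdot (L *m u) (L *m u).
  apply: mxdot_gt0; apply: contra_neq u0 => Lu.
  by rewrite -[u]mul1mx -LL -mulmxA Lu mulmx0.
suff mu0 : 0 <= mu.
  by apply: le_trans (mumin x); rewrite mulr_ge0 // mxdot_ge0.
pose w := M *m u.
(* [2 b] and [g] are the coefficients of [s] and [s^2] in the form of [X - mu L^T L] at [u + s w];
   its value at [u] is zero. *)
pose b := mxdot u (X *m w) - mu * mxdot (L *m w) (L *m u).
pose g := mxdot w (X *m w) - mu * mxdot (L *m w) (L *m w).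
have quad s : 0 <= 2 * s * b + s ^+ 2 * g.
  have := mumin (u + s *: w); rewrite !mulmxDr -!scalemxAr.
  rewrite !mxdotDl !mxdotDr !mxdotZl !mxdotZr (mxdotC (L *m u)).
  have -> : mxdot w (X *m u) = mxdot u (X *m w).
    by rewrite mxdotC mxdot_mull XT.
  rewrite umu /b /g; set p := mxdot _ _; set q := mxdot _ _.
  set r := mxdot _ _; set t := mxdot _ _; set z := mxdot _ _ => h.
  lra.
have b0 : b = 0.
  apply/eqP; rewrite -sqrf_eq0 eq_le sqr_ge0 andbT leNgt; apply/negP => b2.
  have g1 : 0 < `|g| + 1 by rewrite ltr_wpDl.
  (* Here the parabola equals [b^2 / k^2 (g - 2 k)] with [k = |g| + 1 >= g], which is negative
     unless [b = 0]. *)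
  have := quad (- b / (`|g| + 1)).
  have : g <= `|g| + 1 by rewrite (le_trans (ler_norm g)) // lerDl.
  move: (`|g| + 1) g1 => k k0 gk.
  have -> : 2 * (- b / k) * b + (- b / k) ^+ 2 * g =
    (b ^+ 2 / k ^+ 2) * (g - 2 * k) by field; rewrite gt_eqF.
  rewrite pmulr_rge0; last by rewrite divr_gt0 // exprn_gt0.
  lra.
have h1 := XM u; have h2 := LM u; have h3 := mulr_gt0 c0 Lu.
rewrite -/w in h1 h2.
(* This inner product is negative by contraction, while [b = 0] equates [mu] times it with the
   nonpositive [mxdot u (X *m w)]. *)
have h4 : mxdot (L *m w) (L *m u) < 0 by lra.
have e : mu * mxdot (L *m w) (L *m u) <= 0.
  by move: b0; rewrite /b => b0; lra.
by move: e; rewrite nmulr_lle0.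
Qed.
End Lyapunov.

(** * Closed loop of a Riccati equation *)

Section Control.
Variable R : realType.
Implicit Types n : nat.

Lemma posdef_mxdot n (M : 'M[R]_n) (x : 'cV[R]_n) :
  posdef M -> x != 0 -> 0 < mxdot x (M *m x).
Proof. by move=> [_ Mpos] /Mpos; rewrite quad_mxdot. Qed.

Lemma posdef_mxdot_ge0 n (M : 'M[R]_n) (x : 'cV[R]_n) :
  posdef M -> 0 <= mxdot x (M *m x).
Proof.
move=> Mpos; have [->|x0] := eqVneq x 0; first by rewrite mulmx0 mxdot0r.
exact/ltW/posdef_mxdot.
Qed.

Lemma posdef_unit n (M : 'M[R]_n) : posdef M -> M \in unitmx.
Proof.
move=> Mpos; rewrite -row_free_unit; apply/inj_row_free => v vM.
apply/eqP; apply: contraT => v0; have [MT _] := Mpos.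
have : M *m v^T = 0 by rewrite -MT -trmx_mul vM trmx0.
move=> Mv; have := posdef_mxdot Mpos (_ : v^T != 0).
by rewrite trmx_eq0 Mv mxdot0r ltxx; apply.
Qed.

Lemma posdef_invmx n (M : 'M[R]_n) : posdef M -> posdef (invmx M).
Proof.
move=> Mpos; have Mu := posdef_unit Mpos; have [MT _] := Mpos.
split=> [|x x0]; first by rewrite trmx_inv MT.
rewrite quad_mxdot -{1}[x](mulKVmx Mu) mxdotC.
apply: posdef_mxdot => //; apply: contra_neq x0 => x0.
by rewrite -[x](mulKVmx Mu) x0 mulmx0.
Qed.

(** The rows of the matrices [C A^k] with [k < n] span the whole space, and all of them annihilate
    [y]. *)
Lemma observable_eq0 n p (A : 'M[R]_n) (C : 'M[R]_(p, n)) (y : 'cV[R]_n) :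
  observable A C -> (forall k, C *m iter k (mulmx A) y = 0) -> y = 0.
Proof.
rewrite /observable /controllable => obs Cy.
rewrite -[y]mul1mx; apply/sub_kermxP; apply: submx_trans obs _.
apply/sumsmx_subP => k _; rewrite genmxE; apply/sub_kermxP.
rewrite trmx_mul trmxK -mulmxA -(Cy k); congr (_ *m _).
elim: {k}(nat_of_ord k) {Cy} y => [|k IH] y.
  by rewrite expr0 trmx1 mul1mx.
by rewrite exprS -mulmxE trmx_mul trmxK -mulmxA IH iterSr.
Qed.

Section Riccati.
Variables (r p m : nat) (A : 'M[R]_r) (G : 'M[R]_(r, m)) (C : 'M[R]_(p, r)).
Variables (W : 'M[R]_p) (X : 'M[R]_r).
Hypotheses (Wpos : posdef W) (Xpos : posdef X).
Hypothesis ric : riccati_rhs A G C W X = 0.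
Let E : 'M[R]_r := invmx X.
Let S : 'M[R]_r := C^T *m W *m C.
Let F : 'M[R]_r := A - X *m C^T *m W *m C.

(** Multiplying the Riccati equation by [E = X^-1] on both sides turns it into a Lyapunov equation
    for [E] along the closed loop [F]. *)
Lemma riccati_inverse :
  E *m F + F^T *m E = - (E *m G *m (E *m G)^T + S).
Proof.
have Xu := posdef_unit Xpos.
have [XT _] := Xpos; have [WT _] := Wpos.
have ET : E^T = E by rewrite /E trmx_inv XT.
have e : E *m A + A^T *m E + E *m G *m G^T *m E - S = 0.
  have := congr1 (fun Y => E *m Y *m E) ric.
  rewrite /riccati_rhs mulmx0 mul0mx !(mulmxDr, mulmxDl, mulmxN, mulNmx) => <-.
  rewrite /S !mulmxA mulVmx // !mul1mx -!mulmxA mulmxV // !mulmx1 !mulmxA.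
  by rewrite -/E.
have -> : E *m F = E *m A - S.
  by rewrite mulmxBr !mulmxA mulVmx // mul1mx.
have -> : F^T *m E = A^T *m E - S.
  rewrite linearB /= mulmxBl !trmx_mul trmxK XT WT -!mulmxA mulmxV //.
  by rewrite mulmx1 /S mulmxA.
rewrite trmx_mul ET !mulmxA opprD; move/eqP: e.
move: (E *m A) (A^T *m E) (E *m G *m _ *m _) => a b c.
rewrite subr_eq0 => /eqP <-.
by apply/matrixP => i j; rewrite !mxE; ring.
Qed.

(** Both terms on the right are nonpositive, so [E] is a Lyapunov function for [F]. The identity
    serves the stability of [F] and later the comparison of [E] with the observability Gramian. *)
Lemma riccati_dissipation (x : 'cV[R]_r) :
  2 * mxdot x (E *m (F *m x)) =
  - mxdot ((E *m G)^T *m x) ((E *m G)^T *m x) - mxdot (C *m x) (W *m (C *m x)).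
Proof.
have [XT _] := Xpos.
have ET : E^T = E by rewrite /E trmx_inv XT.
have -> : 2 * mxdot x (E *m (F *m x)) = mxdot x ((E *m F + F^T *m E) *m x).
  rewrite mulmxDl mxdotDr mulmxA mulr_natl mulr2n; congr (_ + _).
  by rewrite mxdotC -mulmxA mxdot_mull ET mxdot_mull mulmxA.
rewrite riccati_inverse mulNmx mulmxDl mxdotNr mxdotDr opprD.
by rewrite !mxdot_mull !trmxK !mulmxA.
Qed.

(* Right eigenvectors, because observability is what survives the compression
   to an invariant subspace; controllability need not. *)
Lemma riccati_closed_loop_stable :
  (forall (a b : 'cV[R]_r) s t, A *m a = s *: a - t *: b ->
     A *m b = t *: a + s *: b -> C *m a = 0 -> C *m b = 0 ->
     a = 0 /\ b = 0) ->
  stable F.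
Proof.
move=> obs z /real_eigenpair[a [b [ab Fa Fb]]]; rewrite ltNge; apply/negP => z0.
have [XT _] := Xpos.
have ET : E^T = E by rewrite /E trmx_inv XT.
have Epos : posdef E by exact: posdef_invmx.
have da := riccati_dissipation a; have db := riccati_dissipation b.
have Eab : mxdot b (E *m a) = mxdot a (E *m b).
  by rewrite mxdotC mxdot_mull ET.
have e : mxdot a (E *m (F *m a)) + mxdot b (E *m (F *m b)) =
   complex.Re z * (mxdot a (E *m a) + mxdot b (E *m b)).
  rewrite Fa Fb !mulmxDr !mulmxN -!scalemxAr !mxdotDr mxdotNr !mxdotZr Eab.
  by ring.
have ge : 0 <= complex.Re z * (mxdot a (E *m a) + mxdot b (E *m b)).
  by rewrite mulr_ge0 // addr_ge0 // posdef_mxdot_ge0.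
have ga := mxdot_ge0 ((E *m G)^T *m a); have gb := mxdot_ge0 ((E *m G)^T *m b).
have ca := posdef_mxdot_ge0 (C *m a) Wpos.
have cb := posdef_mxdot_ge0 (C *m b) Wpos.
(* If [Re z >= 0], the two dissipation identities add up to a nonnegative number equal to a sum of
   nonpositive ones, so every term vanishes. *)
have Ca : C *m a = 0.
  by apply/eqP/negPn/negP => /(posdef_mxdot Wpos) h;
     clear -da db e ge ga gb ca cb h; lra.
have Cb : C *m b = 0.
  by apply/eqP/negPn/negP => /(posdef_mxdot Wpos) h;
     clear -da db e ge ga gb ca cb h; lra.
have FA x : C *m x = 0 -> F *m x = A *m x.
  by move=> Cx; rewrite mulmxBl -!mulmxA Cx !mulmx0 subr0.
rewrite FA // in Fa; rewrite FA // in Fb.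
have [a0 b0] := obs _ _ _ _ Fa Fb Ca Cb.
by move: ab; rewrite a0 b0 eqxx.
Qed.
End Riccati.

(** The span of [U a] and [U b] is [A]-invariant and killed by [C], so all iterates of both vectors
    are unobservable; [U] is injective. *)
Lemma invariant_unobservable n r p (A : 'M[R]_n) (C : 'M[R]_(p, n))
    (U : 'M[R]_(n, r)) :
  observable A C -> stiefel U -> A *m U = U *m (U^T *m A *m U) ->
  forall (a b : 'cV[R]_r) s t,
    U^T *m A *m U *m a = s *: a - t *: b ->
    U^T *m A *m U *m b = t *: a + s *: b ->
    C *m U *m a = 0 -> C *m U *m b = 0 -> a = 0 /\ b = 0.
Proof.
move=> obs UU AU a b s t Aa Ab Ca Cb.
have iterE k : exists u v u' v' : R, 
   iter k (mulmx A) (U *m a) = U *m (u *: a + v *: b) /\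
   iter k (mulmx A) (U *m b) = U *m (u' *: a + v' *: b).
  elim: k => [|k [u [v [u' [v' [IHa IHb]]]]]].
    by exists 1, 0, 0, 1; rewrite !scale0r !scale1r addr0 add0r.
  have step x y : exists x' y' : R,
      A *m (U *m (x *: a + y *: b)) = U *m (x' *: a + y' *: b).
    exists (x * s + y * t), (y * s - x * t); rewrite !mulmxA AU -!mulmxA.
    congr (U *m _); rewrite !mulmxA mulmxDr -!scalemxAr Aa Ab.
    by apply/matrixP => i j; rewrite !mxE; ring.
  rewrite !iterS IHa IHb.
  have [x1 [y1 ->]] := step u v; have [x2 [y2 ->]] := step u' v'.
  by exists x1, y1, x2, y2.
have UI (x : 'cV[R]_r) : U *m x = 0 -> x = 0.
  by move=> Ux; rewrite -[x]mul1mx -UU -mulmxA Ux mulmx0.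
have comb u v : C *m (U *m (u *: a + v *: b)) = 0.
  by rewrite !mulmxA mulmxDr -!scalemxAr Ca Cb !scaler0 addr0.
by split; apply/UI/(observable_eq0 obs) => k;
  have [u [v [u' [v' [ea eb]]]]] := iterE k; rewrite ?ea ?eb comb.
Qed.
End Control.

(** * Compression to an invariant subspace *)

Section InvariantSubspace.
Variables (R : realType) (n r : nat) (A : 'M[R]_n) (Psi : 'M[R[i]]_n).
Variable U : 'M[R]_(n, r).
Hypotheses (jordA : jordan_basis A Psi) (calU : in_calU Psi U).
Let J := invmx Psi *m toCmx A *m Psi.
Let B := invmx Psi *m toCmx U.
Let I : 'M[R[i]]_(n, r) := pid_mx r.

Lemma jordan_upper (i j : 'I_n) : (j < i)%N -> J i j = 0.
Proof.
move=> ji; have [_ jordJ _ _] := jordA; have [J0 _] := jordJ i j.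
by apply: J0; lia.
Qed.

Let Psiu : Psi \in unitmx. Proof. by have [] := jordA. Qed.

Let pidK (X : 'M[R[i]]_(n, r)) :
  (forall (i : 'I_n) (j : 'I_r), (r <= i)%N -> X i j = 0) -> X = I *m (I^T *m X).
Proof.
move=> X0; rewrite mulmxA /I tr_pid_mx mul_pid_mx !minnn.
apply/matrixP => i j; rewrite mxE (bigD1 i) //= mxE eqxx /=.
rewrite big1 => [|k ki]; last first.
  by rewrite mxE (eq_sym (i : nat)) val_eqE (negbTE ki) mul0r.
have [ir|/X0->] := ltnP i r; last by rewrite mulr0 addr0.
by rewrite mul1r addr0.
Qed.

Let toCmx_stiefel : (toCmx U)^T *m toCmx U = 1%:M.
Proof.
have [UU _] := calU; rewrite /toCmx map_trmx -map_mxM -/(toCmx _) UU.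
exact: map_mx1.
Qed.

Let BE : B = I *m (I^T *m B).
Proof. by apply: pidK => i j; have [_] := calU; apply. Qed.

Let UE : toCmx U = Psi *m I *m (I^T *m B).
Proof. by rewrite -mulmxA -BE /B mulKVmx. Qed.

(** The top block of [Psi^-1 U] is square, and [U^T U = 1] provides a left inverse for it. *)
Let Ku : I^T *m B \in unitmx.
Proof.
have := toCmx_stiefel; rewrite {2}UE mulmxA => /mulmx1_unit[_].
by [].
Qed.

(** Being upper triangular, [J] preserves the span of the first [r] coordinate vectors, which [Psi]
    maps onto the range of [U]. Then [U^T U = 1] identifies the matrix of the restriction. *)
Lemma calU_invariant : A *m U = U *m (U^T *m A *m U).
Proof.
have JB : J *m B = I *m (I^T *m (J *m B)).
  apply: pidK => i j ri; rewrite mxE big1 // => k _.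
  have [ki|ik] := ltnP k i; first by rewrite jordan_upper ?mul0r.
  have [_ ->] := calU; rewrite ?mulr0 //; exact: leq_trans ik.
pose X := invmx (I^T *m B) *m (I^T *m (J *m B)).
have AU : toCmx A *m toCmx U = toCmx U *m X.
  rewrite {2}UE /X -mulmxA (mulKVmx Ku) -mulmxA -JB /J /B !mulmxA mulmxV //.
  by rewrite mul1mx mulmxK.
have XE : X = toCmx (U^T *m A *m U).
  have -> : X = (toCmx U)^T *m (toCmx U *m X).
    by rewrite mulmxA toCmx_stiefel mul1mx.
  by rewrite -AU /toCmx !map_mxM map_trmx mulmxA.
move: AU; rewrite XE /toCmx -!map_mxM => /map_mx_inj; apply.
Qed.

(* Left eigenvectors of the closed loop either restrict to the invariant
   subspace, or vanish on it and are then left eigenvectors of [A]. *)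
Lemma closed_loop_eigenvalue (N : 'M[R]_(r, n)) (z : R[i]) :
  eigenvalue (toCmx (A - U *m N)) z ->
  eigenvalue (toCmx (U^T *m A *m U - N *m U)) z \/
  exists2 k : 'I_n, (r <= k)%N & z = J k k.
Proof.
move=> /eigenvalueP[v vM v0].
have MU : (A - U *m N) *m U = U *m (U^T *m A *m U - N *m U).
  by rewrite mulmxBl mulmxBr calU_invariant !mulmxA.
have [vU|vU] := eqVneq (v *m toCmx U) 0; last first.
  left; apply/eigenvalueP; exists (v *m toCmx U) => //.
  have := congr1 (mulmx v) (congr1 (@toCmx R _ _) MU).
  by rewrite /toCmx !map_mxM !mulmxA [v *m _]vM -scalemxAl.
right.
have vA : v *m toCmx A = z *: v.
  rewrite -vM /toCmx map_mxB mulmxBr map_mxM [X in _ - X]mulmxA vU.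
  by rewrite mul0mx subr0.
pose w := v *m Psi.
have wJ : w *m J = z *: w.
  by rewrite /w /J !mulmxA mulmxK // vA scalemxAl.
have w0 : w != 0.
  by apply: contra_neq v0 => w0; rewrite -[v](mulmxK Psiu) -/w w0 mul0mx.
have wI : w *m I = 0.
  by apply: (can_inj (mulmxK Ku)); rewrite mul0mx -vU UE /w !mulmxA.
have wlow (i : 'I_n) : (i < r)%N -> w 0 i = 0.
  move=> ir; move/rowP/(_ (Ordinal ir)): wI; rewrite mxE (bigD1 i) //=.
  rewrite [in X in _ = X]mxE.
  rewrite big1 => [|k ki]; last first.
    by rewrite [I _ _]mxE /= val_eqE (negbTE ki) mulr0.
  by rewrite [I _ _]mxE /= eqxx ir mulr1 addr0.
have [i0 wi0] : exists i0, w 0 i0 != 0.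
  by apply/existsP; apply: contraNT w0; rewrite negb_exists => /forallP w0;
    apply/eqP/rowP => i; rewrite [RHS]mxE; apply/eqP/negPn; exact: w0.
(* At the first nonzero coordinate of [w], triangularity of [J] reduces [w J = z w] to [z = J k k];
   the coordinates before [r] vanish, so [k >= r]. *)
have [k wk kmin] :=
  @arg_minnP _ i0 (fun i => w 0 i != 0) (fun i : 'I_n => nat_of_ord i) wi0.
exists k.
  by rewrite leqNgt; apply/negP => /wlow wk0; rewrite wk0 eqxx in wk.
have := congr1 (fun u : 'rV_n => u 0 k) wJ.
rewrite [LHS]mxE [RHS]mxE (bigD1 k) //= big1.
  by rewrite addr0 mulrC => /(mulIf wk).
move=> i ik; have [ki|ik'] := leqP k i.
  by rewrite jordan_upper ?mulr0 // ltn_neqAle ki eq_sym ik.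
have [->|/kmin] := eqVneq (w 0 i) 0; first by rewrite mul0r.
by rewrite leqNgt ik'.
Qed.

(** For the last index [k >= l] with the diagonal entry of [l], row [k] of [J] is purely diagonal.
    Row [k] of [Psi^-1] is then a left eigenvector of [A], and it kills [U] since [k >= r], so the
    feedback leaves it unchanged. *)
Lemma complement_eigenvalue (N : 'M[R]_(r, n)) (l : 'I_n) : (r <= l)%N ->
  eigenvalue (toCmx (A - U *m N)) (J l l).
Proof.
move=> rl.
pose P (k : 'I_n) := (l <= k)%N && (J k k == J l l).
have Pl : P l by rewrite /P leqnn eqxx.
have [k /andP[lk /eqP Jk] kmax] :=
  @arg_maxnP _ l P (fun i : 'I_n => nat_of_ord i) Pl.
have rowJ (j : 'I_n) : j != k -> J k j = 0.
  move=> jk; have [_ jordJ _ _] := jordA; have [J0 J1] := jordJ k j.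
  have [jk1|jk1] := eqVneq (j : nat) k.+1.
    case: (J1 jk1) => // -[_ JJ].
    have /kmax : P j by rewrite /P jk1 (leq_trans lk) //= -Jk; apply/eqP/esym.
    by rewrite /= jk1 ltnn.
  by apply: J0; apply/eqP.
pose v : 'rV_n := row k (invmx Psi).
have vPsi : v *m Psi = delta_mx 0 k by rewrite /v rowE mulmxKV.
have vA : v *m toCmx A = J l l *: v.
  apply: (can_inj (mulmxK Psiu)); rewrite -scalemxAl vPsi /v -!row_mul -/J.
  apply/rowP => j; rewrite [LHS]mxE !(mxE scalemx_key) [delta_mx _ _ _ _]mxE /=.
  have [->|jk] := eqVneq j k; first by rewrite Jk mulr1.
  by rewrite rowJ // mulr0.
have vU : v *m toCmx U = 0.
  apply/rowP => j; rewrite /v -row_mul mxE [RHS]mxE.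
  by have [_] := calU; apply; exact: leq_trans lk.
apply/eigenvalueP; exists v.
  rewrite /toCmx map_mxB map_mxM mulmxBr [X in _ - X]mulmxA vU mul0mx subr0.
  exact: vA.
apply/eqP => v0; move/rowP/(_ k): vPsi.
by rewrite v0 mul0mx !mxE !eqxx /= => /esym/eqP; rewrite oner_eq0.
Qed.

(** The real parts are sorted, so the unstable indices form an initial segment; the zero-based index
    [r] is the first discarded eigenvalue. *)
Lemma n_unstable_leP (l : 'I_n) : l = r :> nat ->
  (n_unstable A Psi <= r)%N = (complex.Re (J l l) < 0).
Proof.
move=> lr; have [_ _ Jsort _] := jordA; rewrite /n_unstable /eig -/J in Jsort *.
have rn : (r < n)%N by rewrite -lr.
have [Jl|Jl] := ltP (complex.Re (J l l)) 0.
  apply: (@leq_trans #|[set widen_ord (ltnW rn) i | i : 'I_r]|); last first.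
    by rewrite (leq_trans (leq_imset_card _ _)) // card_ord.
  apply/subset_leq_card/fintype.subsetP => k; rewrite inE => Jk.
  have kr : (k < r)%N.
    rewrite ltnNge; apply/negP; rewrite -lr => /Jsort.
    by rewrite leNgt (lt_le_trans Jl Jk).
  by apply/imsetP; exists (Ordinal kr) => //; apply: val_inj.
apply/negbTE; rewrite -ltnNge -[X in (X <= _)%N](card_ord r.+1).
have wI : injective (widen_ord rn) by move=> i j /(congr1 val) /= /val_inj.
rewrite -(card_imset _ wI).
apply/subset_leq_card/fintype.subsetP => k /imsetP[i _ ->]; rewrite inE.
apply: le_trans Jl (Jsort _ _ _); rewrite lr -ltnS; exact: (ltn_ord i).
Qed.

Lemma closed_loop_stable_iff (N : 'M[R]_(r, n)) : (r < n)%N ->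
  stable (U^T *m A *m U - N *m U) ->
  stable (A - U *m N) <-> (n_unstable A Psi <= r)%N.
Proof.
move=> rn sF; pose l := Ordinal rn.
rewrite (@n_unstable_leP l) //; split => [sM|Jl z].
  exact/sM/complement_eigenvalue.
case/closed_loop_eigenvalue => [/sF //|[k rk ->]].
have [_ _ Jsort _] := jordA.
exact: le_lt_trans (Jsort l k rk) Jl.
Qed.
End InvariantSubspace.

(** * Differentiation and limits of matrix functions *)

Definition mxder (R : realType) m n (F : R -> 'M[R]_(m, n)) (t : R)
    (dF : 'M[R]_(m, n)) : Prop :=
  forall i j, is_derive t 1 (fun s => F s i j) (dF i j).

(** The filter is a parameter because limits are taken at [0^'+], at a point and at [+oo]; in the
    last case this is [mx_converges]. *)
Definition mxcvg (R : realType) T m n (f : T -> 'M[R]_(m, n))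
    (FF : set_system T) (l : 'M[R]_(m, n)) : Prop :=
  forall i j, (f s i j @[s --> FF] --> l i j)%classic.

Section MatrixDerivative.
Variables (R : realType) (t : R).

Lemma is_derive_big_sum I (r : seq I) (f : I -> R -> R) (df : I -> R) :
  (forall i, is_derive t 1 (f i) (df i)) ->
  is_derive t 1 (fun s => \sum_(i <- r) f i s) (\sum_(i <- r) df i).
Proof.
move=> fdf; elim: r => [|i r IH].
  rewrite big_nil; under eq_fun do rewrite big_nil.
  exact: is_derive_cst.
rewrite big_cons; under eq_fun do rewrite big_cons.
exact: is_deriveD.
Qed.

Lemma is_derive_prod n (f : 'I_n -> R -> R) (df : 'I_n -> R) :
  (forall i, is_derive t 1 (f i) (df i)) ->
  is_derive t 1 (fun s => \prod_(i < n) f i s)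
    (\sum_(i < n) \prod_(k < n) (if k == i then df k else f k t)).
Proof.
elim: n f df => [|n IH] f df fdf.
  rewrite big_ord0; under eq_fun do rewrite big_ord0.
  exact: is_derive_cst.
under eq_fun do rewrite big_ord_recl.
have := is_deriveM (fdf ord0) (IH _ _ (fun i => fdf (lift ord0 i))).
move/is_derive_eq; apply; rewrite big_ord_recl addrC; congr (_ + _).
  rewrite big_ord_recl eqxx [RHS]mulrC; congr (_ * _).
rewrite scaler_sumr; apply: eq_bigr => i _; rewrite [RHS]big_ord_recl /=.
by congr (_ * _); apply: eq_bigr => k _; rewrite (inj_eq lift_inj).
Qed.

Lemma mxder_cst m n (A : 'M[R]_(m, n)) : mxder (fun=> A) t 0.
Proof. by move=> i j; rewrite mxE; exact: is_derive_cst. Qed.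

Lemma mxderD m n (F G : R -> 'M[R]_(m, n)) dF dG :
  mxder F t dF -> mxder G t dG -> mxder (fun s => F s + G s) t (dF + dG).
Proof.
move=> FdF GdG i j; under eq_fun do rewrite mxE.
by rewrite mxE; exact: is_deriveD.
Qed.

Lemma mxder_tr m n (F : R -> 'M[R]_(m, n)) dF :
  mxder F t dF -> mxder (fun s => (F s)^T) t dF^T.
Proof.
move=> FdF i j; under eq_fun do rewrite mxE.
by rewrite mxE; exact: FdF.
Qed.

Lemma mxderM m n p (F : R -> 'M[R]_(m, n)) (G : R -> 'M[R]_(n, p)) dF dG :
  mxder F t dF -> mxder G t dG ->
  mxder (fun s => F s *m G s) t (dF *m G t + F t *m dG).
Proof.
move=> FdF GdG i j; under eq_fun do rewrite mxE.
rewrite !mxE -big_split /=; apply: is_derive_big_sum => k.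
have := is_deriveM (FdF i k) (GdG k j).
by move/is_derive_eq; apply; rewrite addrC; congr (_ + _); exact: mulrC.
Qed.

Lemma mxderZ m n (a : R -> R) (F : R -> 'M[R]_(m, n)) da dF :
  is_derive t 1 a da -> mxder F t dF ->
  mxder (fun s => a s *: F s) t (da *: F t + a t *: dF).
Proof.
move=> ada FdF i j; under eq_fun do rewrite mxE.
have := is_deriveM ada (FdF i j).
by move/is_derive_eq; apply; rewrite !mxE addrC; congr (_ + _); exact: mulrC.
Qed.

Lemma mxderMl m n p (A : 'M[R]_(m, n)) (F : R -> 'M[R]_(n, p)) dF :
  mxder F t dF -> mxder (fun s => A *m F s) t (A *m dF).
Proof.
move=> FdF; have := mxderM (mxder_cst A) FdF.
by rewrite mul0mx add0r.
Qed.

Lemma mxderMr m n p (A : 'M[R]_(n, p)) (F : R -> 'M[R]_(m, n)) dF :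
  mxder F t dF -> mxder (fun s => F s *m A) t (dF *m A).
Proof.
move=> FdF; have := mxderM FdF (mxder_cst A).
by rewrite mulmx0 addr0.
Qed.

Lemma is_derive_mxtrace n (F : R -> 'M[R]_n) dF :
  mxder F t dF -> is_derive t 1 (fun s => \tr (F s)) (\tr dF).
Proof. by move=> FdF; exact: is_derive_big_sum. Qed.

Lemma is_derive_mxdot m n (F : R -> 'M[R]_(m, n)) dF :
  mxder F t dF ->
  is_derive t 1 (fun s => mxdot (F s) (F s)) (2 * mxdot dF (F t)).
Proof.
move=> FdF; have := is_derive_mxtrace (mxderM (mxder_tr FdF) FdF).
move/is_derive_eq; apply; rewrite linearD /= -!/(mxdot _ _) (mxdotC (F t)).
by rewrite mulr_natl mulr2n.
Qed.

Lemma mxder_unique m n (F : R -> 'M[R]_(m, n)) dF dF' :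
  mxder F t dF -> mxder F t dF' -> dF = dF'.
Proof.
move=> h h'; apply/matrixP => i j.
rewrite -(@derive_val _ _ _ _ _ _ _ (h i j)).
by rewrite -(@derive_val _ _ _ _ _ _ _ (h' i j)).
Qed.

(** Jacobi's formula: the Leibniz expansion is differentiated one row at a time, and [Fi i] carries
    the differentiated row [i]. *)
Lemma is_derive_det n (F : R -> 'M[R]_n) dF : mxder F t dF ->
  is_derive t 1 (fun s => \det (F s)) (\tr (\adj (F t) *m dF)).
Proof.
move=> FdF.
pose Fi i : 'M[R]_n := \matrix_(k, l) if k == i then dF k l else F t k l.
have -> : \tr (\adj (F t) *m dF) = \sum_i \det (Fi i).
  rewrite /mxtrace; under eq_bigr => i _ do rewrite mxE.
  rewrite exchange_big; apply: eq_bigr => i _ /=.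
  rewrite (expand_det_row _ i); apply: eq_bigr => j _.
  rewrite !mxE eqxx mulrC; congr (_ * (_ * \det _)).
  by apply/matrixP => k l; rewrite !mxE eq_sym (negbTE (neq_lift _ _)).
rewrite /determinant exchange_big /=; apply: is_derive_big_sum => s.
have := is_deriveM (is_derive_cst ((-1) ^+ odd_perm s : R) t 1)
  (is_derive_prod (fun i => FdF i (s i))).
move/is_derive_eq; apply; rewrite scaler0 addr0 scaler_sumr.
apply: eq_bigr => i _; congr (_ * _); apply: eq_bigr => k _.
by rewrite mxE.
Qed.

(** Cofactors are signed determinants, so Jacobi's formula applies to each entry. *)
Lemma mxder_adj n (F : R -> 'M[R]_n) dF : mxder F t dF ->
  exists dA, mxder (fun s => \adj (F s)) t dA.
Proof.
move=> FdF.
pose g i j s := row' j (col' i (F s)).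
have gd i j : mxder (g i j) t (row' j (col' i dF)).
  move=> k l; under eq_fun do rewrite !mxE.
  by rewrite !mxE; exact: FdF.
exists (\matrix_(i, j)
  ((-1) ^+ (j + i) * \tr (\adj (g i j t) *m row' j (col' i dF)))).
move=> i j; under eq_fun do rewrite mxE /cofactor.
have := is_deriveM (is_derive_cst ((-1) ^+ (j + i) : R) t 1)
  (is_derive_det (gd i j)).
by move/is_derive_eq; apply; rewrite scaler0 addr0 mxE.
Qed.

(* The formula below avoids [invmx], which is only the inverse where [F] is
   invertible and is not known to be so on a neighbourhood of [t]. *)
Lemma mxder_inv n (F : R -> 'M[R]_n) dF : mxder F t dF -> F t \in unitmx ->
  mxder (fun s => (\det (F s))^-1 *: \adj (F s)) t
    (- (invmx (F t) *m dF *m invmx (F t))).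
Proof.
move=> FdF Fu.
have d0 : \det (F t) != 0 by rewrite -unitfE.
have [dA AdA] := mxder_adj FdF.
have dd := is_deriveV d0 (is_derive_det FdF).
have V := mxderZ dd AdA.
set dV := (X in mxder _ _ X) in V.
suff <- : dV = - (invmx (F t) *m dF *m invmx (F t)) by [].
have VF := mxderM V FdF.
(* The rules for products and inverses at [t] give derivative zero here. Comparison with the product
   rule in [VF] then determines [dV]. *)
have VF' : mxder (fun s => ((\det (F s))^-1 * \det (F s))%:M) t (0 : 'M[R]_n).
  move=> i j; under eq_fun do rewrite mxE.
  have [_|_] := eqVneq i j; last first.
    under eq_fun do rewrite mulr0n; rewrite mxE; exact: is_derive_cst.
  under eq_fun do rewrite mulr1n.
  have := is_deriveM dd (is_derive_det FdF).
  move/is_derive_eq; apply; rewrite mxE /GRing.scale /=.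
  by field.
have e : (fun s => ((\det (F s))^-1 *: \adj (F s)) *m F s) =
   (fun s => ((\det (F s))^-1 * \det (F s))%:M).
  by apply/funext => s; rewrite -scalemxAl mul_adj_mx scale_scalar_mx.
rewrite e in VF; have := mxder_unique VF VF'.
have -> : (\det (F t))^-1 *: \adj (F t) = invmx (F t).
  by rewrite /invmx Fu.
move/eqP; rewrite addr_eq0 => /eqP dVF.
by rewrite -mulNmx -dVF mulmxK.
Qed.
End MatrixDerivative.

(** * Entrywise limits along a filter *)

Section MatrixConvergence.
Variables (R : realType) (T : Type) (FF : set_system T).
Context {FFF : Filter FF}.

Lemma mxcvg_cst m n (A : 'M[R]_(m, n)) : mxcvg (fun=> A) FF A.
Proof. by move=> i j; exact: cvg_cst. Qed.

Lemma mxcvgD m n (F G : T -> 'M[R]_(m, n)) A B :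
  mxcvg F FF A -> mxcvg G FF B -> mxcvg (fun s => F s + G s) FF (A + B).
Proof.
move=> FA GB i j; rewrite mxE; under eq_fun do rewrite mxE.
exact: cvgD.
Qed.

Lemma mxcvgN m n (F : T -> 'M[R]_(m, n)) A :
  mxcvg F FF A -> mxcvg (fun s => - F s) FF (- A).
Proof.
by move=> FA i j; rewrite mxE; under eq_fun do rewrite mxE; exact: cvgN.
Qed.

Lemma mxcvg_trmx m n (F : T -> 'M[R]_(m, n)) A :
  mxcvg F FF A -> mxcvg (fun s => (F s)^T) FF A^T.
Proof.
by move=> FA i j; rewrite mxE; under eq_fun do rewrite mxE; exact: FA.
Qed.

Lemma mxcvgM m n p (F : T -> 'M[R]_(m, n)) (G : T -> 'M[R]_(n, p)) A B :
  mxcvg F FF A -> mxcvg G FF B -> mxcvg (fun s => F s *m G s) FF (A *m B).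
Proof.
move=> FA GB i j; rewrite mxE; under eq_fun do rewrite mxE.
apply: cvg_big => [|k _]; first exact: add_continuous.
exact: cvgM.
Qed.

Lemma mxcvgZ m n (a : T -> R) (b : R) (F : T -> 'M[R]_(m, n)) A :
  (a @ FF --> b)%classic -> mxcvg F FF A ->
  mxcvg (fun s => a s *: F s) FF (b *: A).
Proof.
move=> ab FA i j; rewrite mxE; under eq_fun do rewrite mxE.
exact: cvgM.
Qed.

Lemma cvg_mxdot m n (F : T -> 'M[R]_(m, n)) A :
  mxcvg F FF A -> (mxdot (F s) (F s) @[s --> FF] --> mxdot A A)%classic.
Proof.
move=> FA; rewrite mxdotE; under eq_fun do rewrite mxdotE.
apply: cvg_big => [|i _]; first exact: add_continuous.
apply: cvg_big => [|j _]; first exact: add_continuous.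
by apply: cvgM; exact: FA.
Qed.

Lemma cvg_mxtrace n (F : T -> 'M[R]_n) A :
  mxcvg F FF A -> (\tr (F s) @[s --> FF] --> \tr A)%classic.
Proof.
move=> FA; apply: cvg_big => [|i _]; first exact: add_continuous.
exact: FA.
Qed.

Lemma cvg_det n (F : T -> 'M[R]_n) A :
  mxcvg F FF A -> (\det (F s) @[s --> FF] --> \det A)%classic.
Proof.
move=> FA; apply: cvg_big => [|s _]; first exact: add_continuous.
apply: cvgM; first exact: cvg_cst.
apply: cvg_big => [|i _]; first exact: mul_continuous.
exact: FA.
Qed.

Lemma mxcvg_adj n (F : T -> 'M[R]_n) A :
  mxcvg F FF A -> mxcvg (fun s => \adj (F s)) FF (\adj A).
Proof.
move=> FA i j; rewrite mxE; under eq_fun do rewrite mxE.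
apply: cvgM; first exact: cvg_cst.
apply: cvg_det => k l; rewrite !mxE; under eq_fun do rewrite !mxE.
exact: FA.
Qed.

Lemma mxcvg_near m n (F G : T -> 'M[R]_(m, n)) A :
  (\forall s \near FF, F s = G s) -> mxcvg F FF A -> mxcvg G FF A.
Proof.
move=> FG FA i j; apply: cvg_trans (FA i j); apply: near_eq_cvg.
by apply: filterS FG => s ->.
Qed.

Lemma mxcvg_inv n (F : T -> 'M[R]_n) A : A \in unitmx ->
  (\forall s \near FF, F s \in unitmx) -> mxcvg F FF A ->
  mxcvg (fun s => invmx (F s)) FF (invmx A).
Proof.
move=> Au Fu FA; rewrite /invmx Au.
have h : mxcvg (fun s => (\det (F s))^-1 *: \adj (F s)) FF
    ((\det A)^-1 *: \adj A).
  apply: mxcvgZ; last exact: mxcvg_adj.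
  by apply: cvgV; [rewrite -unitfE | exact: cvg_det].
by apply: mxcvg_near h; apply: filterS Fu => s ->.
Qed.

Lemma mxcvg_near_le m n (F : T -> 'M[R]_(m, n)) e : 0 < e -> mxcvg F FF 0 ->
  \forall s \near FF, forall i j, `|F s i j| <= e.
Proof.
move=> e0 F0; apply: filter_forall => i; apply: filter_forall => j.
have := F0 i j; rewrite mxE => /cvgr0Pnorm_le; exact.
Qed.

Lemma mxcvg_mxdot0 m n (F : T -> 'M[R]_(m, n)) :
  (mxdot (F s) (F s) @[s --> FF] --> (0 : R))%classic -> mxcvg F FF 0.
Proof.
move=> h i j; rewrite mxE; apply/cvgr0Pnorm_le => e e0.
have e2 : 0 < e ^+ 2 by rewrite exprn_gt0.
move/cvgr0Pnorm_le: h => /(_ _ e2); apply: filterS => s.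
rewrite (ger0_norm (mxdot_ge0 _)) => h.
rewrite -(@ler_pXn2r _ 2) ?nnegrE ?normr_ge0 ?(ltW e0) //.
by rewrite -normrX ger0_norm ?sqr_ge0 // (le_trans (sqr_entry_le _ i j)).
Qed.
End MatrixConvergence.

(** * Scalar differential equations and inequalities *)

Section ScalarODE.
Variable R : realType.
Local Open Scope classical_set_scope.

Lemma is_derive_continuous (f : R -> R) (t df : R) :
  is_derive t 1 f df -> {for t, continuous f}.
Proof. by move=> [fd _]; apply/differentiable_continuous/derivable1_diffP. Qed.

Lemma within_continuous_right (f : R -> R) (b : R) : 0 < b ->
  f @ 0^'+ --> f 0 -> (forall t : R, 0 < t -> {for t, continuous f}) ->
  {within `[0, b], continuous f}.
Proof.
move=> b0 f0 fc; apply/continuous_within_itvP => //; split => //.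
  by move=> t; rewrite in_itv /= => /andP[t0 _]; exact: fc.
by apply: cvg_at_left_filter; exact: fc.
Qed.

Lemma segment_bounded (f : R -> R) (b : R) : 0 < b ->
  f @ 0^'+ --> f 0 -> (forall t : R, 0 < t -> {for t, continuous f}) ->
  exists2 B : R, 0 <= B & forall t : R, 0 <= t <= b -> `|f t| <= B.
Proof.
move=> b0 f0 fc.
have fw := within_continuous_right b0 f0 fc.
have [c _ fmax] := EVT_max (ltW b0) fw.
have [d _ fmin] := EVT_min (ltW b0) fw.
exists (`|f c| + `|f d|); first by rewrite addr_ge0.
move=> t tb; have tin : t \in `[0, b]%R by rewrite in_itv /= tb.
have h1 := fmax _ tin; have h2 := fmin _ tin.
rewrite ler_norml; have h3 := ler_norm (f c); have h4 := ler_norm (- f d).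
rewrite normrN in h4; have := normr_ge0 (f c); have := normr_ge0 (f d).
by move=> h5 h6; apply/andP; split; lra.
Qed.

Lemma bounded_of_cvg (f : R -> R) (l : R) :
  f @ 0^'+ --> f 0 -> (forall t : R, 0 < t -> {for t, continuous f}) ->
  f @ +oo --> l -> exists B : R, forall t : R, 0 <= t -> `|f t| <= B.
Proof.
move=> f0 fc /cvgrPdist_le/(_ 1 ltr01)[b [_ fl]].
(* Strictly beyond the threshold [b], and positive whatever the sign of [b]. *)
pose b' := Num.max 1 (b + 1).
have b'0 : 0 < b' by rewrite lt_max ltr01.
have [B B0 fB] := segment_bounded b'0 f0 fc.
exists (B + (`|l| + 1)) => t t0; have [tb|bt] := leP t b'.
  by rewrite (le_trans (fB t _)) ?t0 // lerDl addr_ge0.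
have bt' : b < t.
  by apply: le_lt_trans bt; rewrite le_max lerDl ler01 orbT.
apply: (@le_trans _ _ (`|l| + 1)); last by rewrite lerDr.
have h := fl t bt'; rewrite -[f t](subrK l).
by apply: (le_trans (ler_normD _ _)); rewrite addrC lerD2l distrC.
Qed.

(** On [[0, b]] the coefficient is bounded by some [B], so [d^2 exp (2 B s)] is nondecreasing there
    and stays above [d 0 ^ 2 > 0]. *)
Lemma linear_ode_neq0 (d theta : R -> R) :
  d @ 0^'+ --> d 0 -> theta @ 0^'+ --> theta 0 ->
  (forall t : R, 0 < t -> {for t, continuous theta}) ->
  (forall t : R, 0 < t -> is_derive t 1 d (theta t * d t)) ->
  d 0 != 0 -> forall t : R, 0 < t -> d t != 0.
Proof.
move=> d0 th0 thc dd dn0 b b0.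
have [B B0 thB] := segment_bounded b0 th0 thc.
pose g := (fun s : R => d s * d s * expR (2 * B * s)).
have gd (t : R) : 0 < t -> is_derive t 1 g
    ((2 * theta t + 2 * B) * (d t * d t * expR (2 * B * t))).
  move=> t0; have h1 := is_deriveM (dd t t0) (dd t t0).
  have h2 : is_derive t 1 (fun s : R => 2 * B * s) (2 * B).
    have := is_deriveZ (2 * B) (is_derive_id t 1).
    by move/is_derive_eq; apply; rewrite /GRing.scale /= mulr1.
  have h3 := is_derive1_comp (is_derive_expR (2 * B * t)) h2.
  rewrite /g; have := is_deriveM h1 h3; move/is_derive_eq; apply.
  by rewrite !fctE /GRing.scale /=; ring.
have gc : {within `[0, b], continuous g}.
  apply: within_continuous_right => //.
    apply: cvgM; first by apply: cvgM.
    apply: continuous_cvg; first exact: continuous_expR.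
    apply: cvgM; first exact: cvg_cst.
    exact: cvg_at_right_filter.
  by move=> t t0; exact: (is_derive_continuous (gd t t0)).
have : g 0 <= g b.
  apply: (@ger0_derive1_ndecr _ g 0 b) => //.
  - by move=> t; rewrite in_itv /= => /andP[t0 _]; have [] := gd t t0.
  - move=> t; rewrite in_itv /= => /andP[t0 tb].
    rewrite derive1E (@derive_val _ _ _ _ _ _ _ (gd t t0)).
    apply: mulr_ge0; last by rewrite mulr_ge0 ?expR_ge0 // -expr2 sqr_ge0.
    have := thB t; rewrite (ltW t0) (ltW tb) => /(_ isT).
    by rewrite ler_norml => /andP[h _]; lra.
  - exact: ltW.
rewrite /g mulr0 expR0 mulr1 => h; apply: contra_neq dn0 => db.
apply/eqP; rewrite -sqrf_eq0 eq_le sqr_ge0 andbT expr2.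
by rewrite db !mul0r in h.
Qed.

(** Once [e <= a * (eta / 2)], the function [(phi - eta / 2) exp (a s)] is nonincreasing, so [phi]
    exceeds [eta / 2] by at most a decaying exponential. *)
Lemma dissipative_cvg0 (phi dphi e : R -> R) (a : R) : 0 < a ->
  (forall t : R, 0 <= phi t) ->
  (forall t : R, 0 < t -> is_derive t 1 phi (dphi t)) ->
  (\forall t \near +oo, dphi t <= - a * phi t + e t) ->
  e @ +oo --> (0 : R) -> phi @ +oo --> (0 : R).
Proof.
move=> a0 phi0 phid diss e0; apply/cvgr0Pnorm_le => eta eta0.
have ae0 : 0 < a * (eta / 2) by rewrite mulr_gt0 // divr_gt0.
move/cvgr0Pnorm_le: e0 => /(_ _ ae0) [b1 [_ eb]].
have [b2 [_ db]] := diss.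
pose b := Num.max 1 (Num.max b1 b2 + 1).
have b0 : 0 < b by rewrite lt_max ltr01.
have bb (t : R) : b < t -> (b1 < t) /\ (b2 < t).
  have h1 : b1 <= Num.max b1 b2 by rewrite le_max lexx.
  have h2 : b2 <= Num.max b1 b2 by rewrite le_max lexx orbT.
  have : Num.max b1 b2 + 1 <= b by rewrite le_max lexx orbT.
  by move=> h3 h4; split; lra.
pose g := (fun s : R => (phi s - eta / 2) * expR (a * s)).
have gd (t : R) : 0 < t -> is_derive t 1 g
    ((dphi t + a * phi t - a * (eta / 2)) * expR (a * t)).
  move=> t0; have h1 := is_deriveB (phid t t0) (is_derive_cst (eta / 2) t 1).
  have h2 : is_derive t 1 (fun s : R => a * s) a.
    have := is_deriveZ a (is_derive_id t 1).
    by move/is_derive_eq; apply; rewrite /GRing.scale /= mulr1.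
  have h3 := is_derive1_comp (is_derive_expR (a * t)) h2.
  rewrite /g; have := is_deriveM h1 h3; move/is_derive_eq; apply.
  by rewrite !fctE /GRing.scale /=; ring.
have gdecr (t : R) : b <= t -> g t <= g b.
  apply: (@ler0_derive1_nincry _ g b) => //.
  - move=> s; rewrite in_itv /= andbT => bs.
    by have [] := gd s (lt_trans b0 bs).
  - move=> s; rewrite in_itv /= andbT => bs.
    rewrite derive1E (@derive_val _ _ _ _ _ _ _ (gd s (lt_trans b0 bs))).
    have [s1 s2] := bb _ bs; have h1 := eb s s1; have h2 := db s s2.
    apply: mulr_le0_ge0; last exact: expR_ge0.
    by move: h1; rewrite ler_norml => /andP[_ h1]; lra.
  - apply: continuous_in_subspaceT => s; rewrite inE /= in_itv /= andbT => bs.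
    exact: (is_derive_continuous (gd s (lt_le_trans b0 bs))).
pose k := `|g b| + 1.
have k0 : 0 < k by rewrite ltr_wpDl.
(* Past this time [exp (a t) >= 1 + a t] gives [k <= eta / 2 * exp (a t)], so the transient fits in
   the other half of [eta]. *)
exists (Num.max b (2 * k / (a * eta))); split; first exact: num_real.
move=> t; rewrite gt_max => /andP[bt kt]; rewrite ger0_norm //.
have h1 := gdecr t (ltW bt).
have h2 : g b <= k by rewrite (le_trans (ler_norm _)) // lerDl.
have h3 := expR_ge1Dx (a * t).
have h4 : k <= eta / 2 * (a * t).
  by move: kt; rewrite ltr_pdivrMr ?mulr_gt0 // => /ltW; lra.
have E0 := expR_gt0 (a * t).
have h5 : k <= eta / 2 * expR (a * t).
  by apply: le_trans h4 _; rewrite ler_pM2l ?divr_gt0 //; lra.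
rewrite -(ler_pM2r E0); move: h1; rewrite {1}/g; lra.
Qed.
End ScalarODE.

Arguments mxcvg_cst {R T FF FFF m n} A.

(** * Lyapunov and Riccati flows *)

Section Flows.
Variable R : realType.
Implicit Types n : nat.

(** The squared norm of [L X L^T] is dissipated. The deviation of [M] from [M0] eventually uses half
    of the rate, and Young's inequality pays for [K] with half of the rest, leaving [c]. *)
Lemma lyapunov_flow_cvg0 n (X M K : R -> 'M[R]_n) (M0 : 'M[R]_n) :
  stable M0 ->
  (forall t : R, 0 < t -> mxder X t (M t *m X t + X t *m (M t)^T + K t)) ->
  mxcvg M (+oo)%classic M0 -> mxcvg K (+oo)%classic 0 ->
  mxcvg X (+oo)%classic 0.
Proof.
move=> /stable_contraction[m [L [L' [c [c0 LL LM]]]]] Xder MM0 K0.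
have Lder (t : R) : 0 < t -> mxder (fun s => L *m X s *m L^T) t
    (L *m (M t *m X t + X t *m (M t)^T + K t) *m L^T).
  by move=> t0; apply/mxderMr/mxderMl/Xder.
have LX0 : mxcvg (fun s => L *m X s *m L^T) (+oo)%classic 0.
  apply: mxcvg_mxdot0.
  pose e s := mxdot (L *m K s *m L^T) (L *m K s *m L^T) / c.
  apply: (@dissipative_cvg0 _ _ _ e c c0 _
    (fun t t0 => is_derive_mxdot (Lder t t0))) => [t||].
  - exact: mxdot_ge0.
  - pose b : R := c / (2 * m.+1%:R).
    have b0 : 0 < b by rewrite divr_gt0 // mulr_gt0.
    have dM : mxcvg (fun s => L *m (M s - M0) *m L') (+oo)%classic 0.
      have := mxcvgM (mxcvgM (mxcvg_cst L) (mxcvgD MM0 (mxcvgN (mxcvg_cst M0))))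
        (mxcvg_cst L').
      by rewrite subrr mulmx0 mul0mx; apply.
    apply: filterS (mxcvg_near_le b0 dM) => t tb.
    have LMt (x : 'cV[R]_n) : mxdot (L *m (M t *m x)) (L *m x) <=
        - (c / 2) * mxdot (L *m x) (L *m x).
      (* Inserting [L' L = 1] lets the perturbation act on [L x], the vector whose norm is
         measured. *)
      have -> : L *m (M t *m x) =
          L *m (M0 *m x) + (L *m (M t - M0) *m L') *m (L *m x).
        rewrite -[(L *m _ *m L') *m _]mulmxA (mulmxA L') LL mul1mx -mulmxA.
        by rewrite -mulmxDr -mulmxDl addrCA subrr addr0.
      rewrite mxdotDl; have h1 := LM x; have h2 := mxdot_mul_le (L *m x) tb.
      have : b * m%:R <= c / 2.
        apply: (@le_trans _ _ (b * m.+1%:R)).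
          by rewrite ler_wpM2l ?(ltW b0) // ler_nat.
        by rewrite le_eqVlt; apply/orP; left; apply/eqP; rewrite /b; field.
      move=> /(ler_wpM2r (mxdot_ge0 (L *m x))); lra.
    rewrite mulmxDr mulmxDl mxdotDl.
    have h1 := lyapunov_contraction LMt (X t).
    have h2 := mxdot_young (L *m K t *m L^T) (L *m X t *m L^T) c0.
    by rewrite /e; lra.
  - pose proof (cvg_mxdot
      (mxcvgM (mxcvgM (mxcvg_cst L) K0) (mxcvg_cst L^T))) as h.
    rewrite mulmx0 mul0mx mxdot0r in h.
    by have := cvgM h (cvg_cst c^-1); rewrite mul0r; apply.
pose proof (mxcvgM (mxcvgM (mxcvg_cst L') LX0) (mxcvg_cst L'^T)) as h.
rewrite mulmx0 mul0mx in h; apply: mxcvg_near h.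
apply: filterE => s; rewrite !mulmxA LL mul1mx -mulmxA -trmx_mul LL trmx1.
by rewrite mulmx1.
Qed.

(** With Jacobi's formula, this turns [N' = N A + B N] into a scalar linear equation for [det N]. *)
Lemma mxtrace_adj_mul n (N A B : 'M[R]_n) :
  \tr (\adj N *m (N *m A + B *m N)) = \tr (A + B) * \det N.
Proof.
rewrite mulmxDr !linearD /= mulmxA mul_adj_mx mul_scalar_mx linearZ /=.
rewrite [X in _ + X = _]mxtrace_mulC -mulmxA mul_mx_adj mul_mx_scalar.
by rewrite linearZ /= -mulrDr mulrC.
Qed.

Lemma riccati_flow_cvg0 n (F S O : 'M[R]_n) (D : R -> 'M[R]_n) :
  stable F -> F^T *m O + O *m F + S = 0 ->
  mxcvg D 0^'+%classic (D 0) ->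
  (forall t : R, 0 < t ->
     mxder D t (F *m D t + D t *m F^T - D t *m S *m D t)) ->
  1%:M + O *m D 0 \in unitmx ->
  mxcvg D (+oo)%classic 0.
Proof.
move=> sF eqO D0 Dder N0u.
pose dD t := F *m D t + D t *m F^T - D t *m S *m D t.
pose N t := 1%:M + O *m D t.
(* Eliminating [S] through the Lyapunov equation for [O] lets the quadratic term be factored. *)
have dDE t : dD t = (1%:M + D t *m O) *m (F *m D t) + D t *m F^T *m N t.
  rewrite /dD; have -> : S = - (F^T *m O + O *m F).
    by apply/eqP; rewrite -addr_eq0 addrC eqO.
  rewrite /N mulmxN mulNmx opprK !mulmxDr !mulmxDl mul1mx mulmx1 !mulmxA.
  move: (F *m D t) (D t *m F^T) (_ *m F^T *m _ *m _) (_ *m O *m F *m _).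
  by move=> a b c d; apply/matrixP => i j; rewrite !mxE; ring.
have dN t : O *m dD t = N t *m (O *m F *m D t) + O *m D t *m F^T *m N t.
  by rewrite dDE /N !(mulmxDr, mulmxDl, mul1mx, mulmx1) !mulmxA.
have Nder (t : R) : 0 < t -> mxder N t (O *m dD t).
  move=> t0; have := mxderD (mxder_cst t 1%:M) (mxderMl O (Dder t t0)).
  by rewrite add0r; apply.
pose theta t := \tr (O *m F *m D t + O *m D t *m F^T).
have thetacvg (FF : set_system R) (FFF : Filter FF) A : mxcvg D FF A ->
    (theta s @[s --> FF] --> \tr (O *m F *m A + O *m A *m F^T))%classic.
  move=> DA; apply: cvg_mxtrace; apply: mxcvgD.
    by apply: mxcvgM DA; exact: mxcvg_cst.
  by apply: mxcvgM (mxcvg_cst _); apply: mxcvgM DA; exact: mxcvg_cst.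
have Dcont (t : R) : 0 < t -> mxcvg D (nbhs t) (D t).
  by move=> t0 i j; exact: is_derive_continuous (Dder t t0 i j).
have detN0 (t : R) : 0 < t -> \det (N t) != 0.
  apply: (@linear_ode_neq0 _ (fun t => \det (N t)) theta) => //.
  - apply: cvg_det; apply: mxcvgD; first exact: mxcvg_cst.
    by apply: mxcvgM D0; exact: mxcvg_cst.
  - exact: thetacvg.
  - by move=> s s0; exact: (thetacvg _ _ _ (Dcont s s0)).
  - move=> s s0; have := is_derive_det (Nder s s0); move/is_derive_eq; apply.
    by rewrite dN mxtrace_adj_mul.
  - by rewrite -unitfE.
have Nu (t : R) : 0 < t -> N t \in unitmx by move/detN0; rewrite unitmxE unitfE.
pose V s := (\det (N s))^-1 *: \adj (N s).
have VE (t : R) : 0 < t -> V t = invmx (N t).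
  by move=> /Nu; rewrite /V /invmx => ->.
pose Z s := D s *m V s.
have Zder (t : R) : 0 < t -> mxder Z t (F *m Z t + Z t *m F^T + 0).
  move=> t0; have := mxderM (Dder t t0) (mxder_inv (Nder t t0) (Nu t t0)).
  rewrite -/(dD t) -/(V t).
  set W := (X in mxder _ _ X); suff -> : W = F *m Z t + Z t *m F^T + 0 by [].
  rewrite /W /Z -(VE t t0) addr0.
  have VN : V t *m N t = 1%:M by rewrite VE // mulVmx // Nu.
  have NV : N t *m V t = 1%:M by rewrite VE // mulmxV // Nu.
  (* [Q] is a left inverse of [1 + D O], and [Q D = D V] is the push-through identity; together they
     make the equation for [Z] linear. *)
  pose Q := 1%:M - D t *m V t *m O.
  have -> : dD t *m V t + D t *m - (V t *m (O *m dD t) *m V t) =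
      Q *m dD t *m V t.
    by move: (dD t) => d; rewrite /Q !mulmxBl mul1mx mulmxN !mulmxA.
  have VOD : V t *m (O *m D t) = 1%:M - V t.
    by rewrite -VN /N mulmxDr mulmx1 addrAC subrr add0r.
  have QD : Q *m D t = D t *m V t.
    rewrite /Q mulmxBl mul1mx -!mulmxA VOD mulmxBr mulmx1 opprB addrCA subrr.
    by rewrite addr0.
  have Q1 : Q *m (1%:M + D t *m O) = 1%:M.
    rewrite mulmxDr mulmx1 [X in _ + X]mulmxA QD /Q.
    by rewrite subrK.
  rewrite dDE mulmxDr (mulmxDl _ _ (V t)) (mulmxA Q (1%:M + _)) Q1 mul1mx.
  by rewrite -!mulmxA NV mulmx1 (mulmxA Q) QD !mulmxA.
have Z0 : mxcvg Z (+oo)%classic 0.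
  apply: (@lyapunov_flow_cvg0 _ Z (fun=> F) (fun=> 0) F) => //.
    exact: mxcvg_cst.
  exact: mxcvg_cst.
(* For positive times this is [N^-1], written through [Z] to expose its limit [1]. Hence [N -> 1]
   and [D = Z N -> 0]. *)
pose V' s := 1%:M - O *m Z s.
have V'1 : mxcvg V' (+oo)%classic 1%:M.
  have := mxcvgD (mxcvg_cst 1%:M) (mxcvgN (mxcvgM (mxcvg_cst O) Z0)).
  by rewrite mulmx0 oppr0 addr0; apply.
have V'N (t : R) : 0 < t -> V' t *m N t = 1%:M.
  move=> t0; have NV : N t *m V t = 1%:M by rewrite VE // mulmxV // Nu.
  suff -> : V' t = V t by rewrite VE // mulVmx // Nu.
  rewrite /V' /Z -NV mulmxA {1}/N mulmxDl mul1mx.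
  by rewrite addrK.
have V'u (t : R) : 0 < t -> V' t \in unitmx.
  by move=> /V'N/mulmx1_unit[].
have N1 : mxcvg (fun s => invmx (V' s)) (+oo)%classic 1%:M.
  rewrite -[1%:M]invmx1; apply: mxcvg_inv V'1; first exact: unitmx1.
  by near=> t; apply: V'u; near: t; exact: nbhs_pinfty_gt.
pose proof (mxcvgM Z0 N1) as h; rewrite mul0mx in h; apply: mxcvg_near h.
near=> t; have t0 : 0 < t by near: t; exact: nbhs_pinfty_gt.
have -> : invmx (V' t) = N t.
  by rewrite -[RHS](mulKmx (V'u _ t0)) V'N // mulmx1.
by rewrite /Z VE // mulmxKV // Nu.
Unshelve. all: by end_near.
Qed.
End Flows.

(** * The filter *)

Section KalmanFilter.
Variable R : realType.
Implicit Types n r p m : nat.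

Lemma mx_ode_sol_mxder n (F : R -> 'M[R]_n) f : mx_ode_sol F f ->
  mxcvg F 0^'+%classic (F 0) /\ forall t : R, 0 < t -> mxder F t (f t (F t)).
Proof.
by move=> Fsol; split=> [i j|t t0 i j]; have [h1 h2] := Fsol i j; [|exact: h2].
Qed.

(** Subtracting the equation of [X] removes the constant terms; symmetry of [X] and [W] gathers the
    linear ones into [F D + D F^T]. *)
Lemma riccati_rhs_shift r p m (A : 'M[R]_r) (G : 'M[R]_(r, m))
    (C : 'M[R]_(p, r)) (W : 'M[R]_p) (X D : 'M[R]_r) :
  X^T = X -> W^T = W -> riccati_rhs A G C W X = 0 ->
  let F := A - X *m C^T *m W *m C in
  riccati_rhs A G C W (X + D) =
    F *m D + D *m F^T - D *m (C^T *m W *m C) *m D.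
Proof.
move=> XT WT ric F.
have FT : F^T = A^T - C^T *m W *m C *m X.
  by rewrite /F linearB /= !trmx_mul trmxK XT WT !mulmxA.
rewrite -[LHS]subr0 -[X in _ - X]ric FT /F /riccati_rhs.
rewrite !(mulmxDl, mulmxDr, mulmxN, mulNmx) !mulmxA.
move: (A *m X) (A *m D) (X *m A^T) (D *m A^T) (G *m G^T).
move: (X *m C^T *m W *m C *m X) (X *m C^T *m W *m C *m D).
move: (D *m C^T *m W *m C *m X) (D *m C^T *m W *m C *m D).
by move=> *; apply/matrixP => i j; rewrite !mxE; ring.
Qed.

Section RiccatiFlow.
Variables (r p m : nat) (A : 'M[R]_r) (G : 'M[R]_(r, m)) (C : 'M[R]_(p, r)).
Variables (W : 'M[R]_p) (X : 'M[R]_r).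
Hypotheses (Wpos : posdef W) (Xpos : posdef X).
Hypothesis ric : riccati_rhs A G C W X = 0.
Let F : 'M[R]_r := A - X *m C^T *m W *m C.
Let S : 'M[R]_r := C^T *m W *m C.
Hypothesis Fstable : stable F.

(* Both [Ob] and [X^-1 - Ob] are nonnegative: they solve Lyapunov inequalities
   for the stable [F]. *)
Lemma riccati_gramian : exists Ob : 'M[R]_r,
  F^T *m Ob + Ob *m F + S = 0 /\
  forall R0, posdef R0 -> 1%:M + Ob *m (R0 - X) \in unitmx.
Proof.
have Xu := posdef_unit Xpos; have [XT _] := Xpos; have [WT _] := Wpos.
have ST : S^T = S by rewrite /S !trmx_mul trmxK WT mulmxA.
have [Ob ObT] := lyapunov_solve (stable_trmx Fstable) ST.
rewrite trmxK => eqO; exists Ob; split=> // R0 R0pos.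
pose E : 'M[R]_r := invmx X.
have ET : E^T = E by rewrite /E trmx_inv XT.
have dissO (x : 'cV[R]_r) :
    2 * mxdot x (Ob *m (F *m x)) = - mxdot (C *m x) (W *m (C *m x)).
  have -> : 2 * mxdot x (Ob *m (F *m x)) = mxdot x ((F^T *m Ob + Ob *m F) *m x).
    rewrite mulmxDl mxdotDr -!mulmxA [in RHS]addrC mulr_natl mulr2n.
    by congr (_ + _); rewrite -[RHS]mxdot_mull [RHS]mxdotC [RHS]mxdot_mull ObT.
  have -> : F^T *m Ob + Ob *m F = - S.
    by apply/eqP; rewrite -addr_eq0 eqO.
  by rewrite mulNmx mxdotNr mxdot_mull -!mulmxA.
have Opos : forall x : 'cV[R]_r, 0 <= mxdot x (Ob *m x).
  apply: (lyapunov_psd Fstable ObT) => x.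
  by have := dissO x; have := posdef_mxdot_ge0 (C *m x) Wpos; lra.
have Ypos : forall x : 'cV[R]_r, 0 <= mxdot x ((E - Ob) *m x).
  apply: (lyapunov_psd Fstable) => [|x]; first by rewrite linearB /= ET ObT.
  rewrite mulmxBl mxdotDr mxdotNr.
  have := dissO x; have := riccati_dissipation Wpos Xpos ric x.
  rewrite -/E -/F; have := mxdot_ge0 ((E *m G)^T *m x); lra.
rewrite -unitmx_tr -row_free_unit; apply/inj_row_free => v.
move=> /(congr1 trmx); rewrite trmx_mul trmxK trmx0.
move: v^T (trmxK v) => y <-; rewrite mulmxDl mul1mx -mulmxA mulmxBl mulmxBr.
(* For a kernel vector [y], put [b = X y] and [a = R0 y], so that [y = E b = Ob b - Ob a].
   Positivity of [E - Ob] at [b] gives [b^T Ob a <= 0], that of [Ob] at [a] then gives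
   [y^T R0 y <= 0], against [R0 > 0]. *)
have yEb : y = E *m (X *m y) by rewrite mulmxA mulVmx // mul1mx.
move: (X *m y) yEb => b yE; pose a := R0 *m y; rewrite -/a => Ny.
have yO : y = Ob *m b - Ob *m a.
  by move/eqP: Ny; rewrite addr_eq0 opprB => /eqP.
have Yb : (E - Ob) *m b = - (Ob *m a).
  by rewrite mulmxBl -yE {1}yO addrAC subrr add0r.
apply/eqP; rewrite trmx_eq0; apply: contraT => y0.
have ya : 0 < mxdot y a by exact: posdef_mxdot.
have h1 := Opos a; have h2 := Ypos b.
have e : mxdot y a = mxdot b (Ob *m a) - mxdot a (Ob *m a).
  by rewrite {1}yO mxdotDl mxdotNl !mxdot_mull ObT.
rewrite Yb mxdotNr in h2.
rewrite e subr_gt0 in ya.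
by have := le_lt_trans h1 ya; rewrite ltNge -oppr_ge0 h2.
Qed.

Lemma riccati_flow_cvg (Rt : R -> 'M[R]_r) : posdef (Rt 0) ->
  mx_ode_sol Rt (fun _ Y => riccati_rhs A G C W Y) ->
  mxcvg Rt (+oo)%classic X.
Proof.
move=> R0pos /mx_ode_sol_mxder[Rt0 Rder].
have [XT _] := Xpos; have [WT _] := Wpos.
have [Ob [eqO N0]] := riccati_gramian.
have D0 : mxcvg (fun t => Rt t - X) (+oo)%classic 0.
  apply: (riccati_flow_cvg0 Fstable eqO) => [|t t0|]; last exact: N0.
    by apply: mxcvgD => //; exact: mxcvg_cst.
  have := mxderD (Rder t t0) (mxder_cst t (- X)).
  rewrite addr0 -{1}(subrK X (Rt t)) [_ - X + X]addrC.
  by rewrite riccati_rhs_shift.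
pose proof (mxcvgD D0 (mxcvg_cst X)) as h; rewrite add0r in h.
by apply: mxcvg_near h; apply: filterE => s; rewrite subrK.
Qed.
End RiccatiFlow.

(** The difference [V - V0] follows a Lyapunov flow forced by the residual of [V0] in the equation
    with [P t]; this tends to the residual with [P0], which is zero. *)
Lemma error_flow_cvg n p (A G : 'M[R]_n) (C : 'M[R]_(p, n)) (W : 'M[R]_p)
    (P : R -> 'M[R]_n) (P0 : 'M[R]_n) (V : R -> 'M[R]_n) :
  P0^T = P0 -> W^T = W -> stable (A - P0 *m C^T *m W *m C) ->
  mxcvg P (+oo)%classic P0 ->
  mx_ode_sol V (fun t Y => err_rhs A G C W (P t) Y) ->
  exists2 V0, mxcvg V (+oo)%classic V0 & err_rhs A G C W P0 V0 = 0.
Proof.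
move=> PT WT sM PP0 /mx_ode_sol_mxder[_ Vder].
pose M t := A - P t *m C^T *m W *m C.
pose Q t := G *m G^T + P t *m C^T *m W *m C *m P t.
pose Q0 := G *m G^T + P0 *m C^T *m W *m C *m P0.
have QT : Q0^T = Q0.
  by rewrite /Q0 linearD /= !trmx_mul !trmxK PT WT !mulmxA.
have [V0 _ eqV0] := lyapunov_solve sM QT.
exists V0; last by rewrite /err_rhs -addrA.
have PC : mxcvg (fun t => P t *m C^T *m W *m C) (+oo)%classic
    (P0 *m C^T *m W *m C).
  by do 3!(apply: mxcvgM; last exact: mxcvg_cst).
have MM0 : mxcvg M (+oo)%classic (A - P0 *m C^T *m W *m C).
  by apply: mxcvgD; [exact: mxcvg_cst | exact: mxcvgN].
have D0 : mxcvg (fun t => V t - V0) (+oo)%classic 0.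
  pose K t := M t *m V0 + V0 *m (M t)^T + Q t.
  apply: (@lyapunov_flow_cvg0 _ _ _ M K _ sM) => // [t t0|].
    have := mxderD (Vder t t0) (mxder_cst t (- V0)).
    rewrite addr0 /err_rhs -/(M t) -addrA -/(Q t).
    set X1 := (X in mxder _ _ X -> _); set X2 := (X in _ -> mxder _ _ X).
    suff -> : X1 = X2 by [].
    rewrite /X1 /X2 /K (mulmxBr (M t)) (mulmxBl (V t)) !addrA.
    move: (M t *m V t) (V t *m (M t)^T) (M t *m V0) (V0 *m (M t)^T) (Q t).
    by move=> *; apply/matrixP => i j; rewrite !mxE; ring.
  rewrite -eqV0; apply: mxcvgD; first apply: mxcvgD.
  - by apply: mxcvgM MM0 _; exact: mxcvg_cst.
  - by apply: mxcvgM; [exact: mxcvg_cst | exact: mxcvg_trmx].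
  - by apply: mxcvgD; [exact: mxcvg_cst | exact: mxcvgM].
pose proof (mxcvgD D0 (mxcvg_cst V0)) as h; rewrite add0r in h.
by apply: mxcvg_near h; apply: filterE => s; rewrite subrK.
Qed.

Lemma mx_ode_sol_bounded n (V : R -> 'M[R]_n) f V0 :
  mx_ode_sol V f -> mxcvg V (+oo)%classic V0 -> mx_bounded V.
Proof.
move=> Vsol VV0.
have bnd i j : exists B : R, forall t : R, 0 <= t -> `|V t i j| <= B.
  have [V0j Vder] := Vsol i j.
  apply: (bounded_of_cvg V0j _ (VV0 i j)) => t t0.
  exact: is_derive_continuous (Vder t t0).
pose B i j := projT1 (cid (bnd i j)).
have BE i j (t : R) : 0 <= t -> `|V t i j| <= B i j.
  by rewrite /B; case: cid => b /= h t0; exact: h.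
have B0 i j : 0 <= B i j by exact: le_trans (normr_ge0 _) (BE i j 0 (lexx 0)).
exists (\sum_i \sum_j B i j) => t t0 i j; apply: le_trans (BE i j t t0) _.
rewrite (bigD1 i) //= (bigD1 j) //= -addrA lerDl.
by apply: addr_ge0; apply: sumr_ge0 => // k _; apply: sumr_ge0.
Qed.
End KalmanFilter.

Theorem theorem3 (R : realType) (n p q r : nat)
    (A G : 'M[R]_n) (C : 'M[R]_(p, n)) (H : 'M[R]_(p, q))
    (Psi : 'M[R[i]]_n) (Ubar : 'M[R]_(n, r)) (Rs : 'M[R]_r) :
  posdef (H *m H^T) ->
  controllable A G -> observable A C ->
  (0 < r < n)%N ->
  jordan_basis A Psi ->
  (forall k l : 'I_n, k.+1 = r -> l = r :> nat ->
     complex.Re (eig A Psi l) < complex.Re (eig A Psi k)) ->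
  in_calU Psi Ubar ->
  let W := invmx (H *m H^T) in
  let AU := Ubar^T *m A *m Ubar in
  let CU := C *m Ubar in
  let GU := Ubar^T *m G in
  posdef Rs ->
  riccati_rhs AU GU CU W Rs = 0 ->
  let Pr := Ubar *m Rs *m Ubar^T in
  (stable (A - Pr *m C^T *m W *m C) <-> (n_unstable A Psi <= r)%N) /\
  (stable (A - Pr *m C^T *m W *m C) ->
   forall (Rt : R -> 'M[R]_r) (Vt : R -> 'M[R]_n),
     posdef (Rt 0) ->
     mx_ode_sol Rt (fun _ X => riccati_rhs AU GU CU W X) ->
     possemidef (Vt 0) ->
     mx_ode_sol Vt
       (fun t V => err_rhs A G C W (Ubar *m Rt t *m Ubar^T) V) ->
     mx_bounded Vt /\
     exists Vinf : 'M[R]_n,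
       mx_converges Vt Vinf /\ err_rhs A G C W Pr Vinf = 0).
Proof.
move=> HHpos _ obs /andP[_ rn] jordA _ calU W AU CU GU Rspos ric Pr.
have Wpos : posdef W by exact: posdef_invmx.
have [RsT _] := Rspos; have [WT _] := Wpos; have [UU _] := calU.
(* Invariance of the range of [Ubar] transfers observability to the compressed pair, in the form of
   its eigenvector test. *)
have sF : stable (AU - Rs *m CU^T *m W *m CU).
  apply: (riccati_closed_loop_stable Wpos Rspos ric).
  exact: invariant_unobservable obs UU (calU_invariant jordA calU).
split=> [|sM Rt Vt R0pos Rsol _ Vsol].
  (* The gain factors as [Ubar N], and [N Ubar] is the feedback term of the reduced closed loop. *)
  pose N := Rs *m CU^T *m W *m C.
  have -> : Pr *m C^T *m W *m C = Ubar *m N.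
    by rewrite /Pr /N /CU trmx_mul !mulmxA.
  apply: (closed_loop_stable_iff jordA calU rn).
  have <- : Rs *m CU^T *m W *m CU = N *m Ubar by rewrite /N {2}/CU !mulmxA.
  exact: sF.
have RtRs := riccati_flow_cvg Wpos Rspos ric sF R0pos Rsol.
have PT : Pr^T = Pr by rewrite /Pr !trmx_mul trmxK RsT mulmxA.
have PtPr : mxcvg (fun t => Ubar *m Rt t *m Ubar^T) (+oo)%classic Pr.
  by apply: mxcvgM (mxcvg_cst _); apply: mxcvgM RtRs; exact: mxcvg_cst.
have [V0 VV0 V0eq] := error_flow_cvg PT WT sM PtPr Vsol.
split; first exact: mx_ode_sol_bounded Vsol VV0.
by exists V0.
Qed.
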